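(* Let $\Omega$ be a connected open set in $\mathbb C$ and $z_0\in\partial\Omega$. Let $u$ be a nonconstant holomorphic function on $\Omega$. Suppose $u$ can be extended smoothly across $z_0$, with the extension still denoted by $u$, and suppose $u(z_0)=0$. Then there exists a neighborhood $U$ of $z_0$ such that the following hold. (1) If $u$ vanishes to finite order at $z_0$, then $$\int_U\frac{|\bar\partial u(z)|^2}{|u(z)|^2}\,dv<\infty\quad\text{and}\quad\int_U\frac{|\partial u(z)|^2}{|u(z)|^2}\,dv=\infty.$$ (2) If $u$ vanishes to infinite order at $z_0$, then $$\int_U\frac{|\bar\partial u(z)|^2}{|u(z)|^2}\,dv=\infty.$$
   Context: ''$u$ extends smoothly across $z_0$'' means that there is an open neighborhood $N$ of $z_0$ and a $C^\infty$ complex-valued function on $\Omega\cup N$ agreeing with $u$ on $\Omega$; $U$ is taken inside $N$. With $z=x_1+ix_2$, $\bar\partial u=\frac12(\partial_{x_1}u+i\partial_{x_2}u)$ and $\partial u=\frac12(\partial_{x_1}u-i\partial_{x_2}u)$; $dv$ is Lebesgue measure on $\mathbb C=\mathbb R^2$. The quotients are taken where $u\neq0$ and set to be $0$ where $u=0$. $u$ vanishes to infinite order at $z_0$ (in the $L^2$ sense) if for all $m\ge0$, $\lim_{r\to0}r^{-m}\int_{|z-z_0|<r}|u|^2dv=0$ (for smooth $u$ this is equivalent to the vanishing of all derivatives at $z_0$); otherwise it vanishes to finite order. *)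

(* Defs.v *)
From HB Require Import structures.
From mathcomp Require Export all_boot all_order all_algebra.
From mathcomp Require Export complex.
From mathcomp Require Export all_classical all_reals all_analysis.
Export Order.TTheory GRing.Theory Num.Theory.
Export numFieldNormedType.Exports.

Set Implicit Arguments.
Unset Strict Implicit.
Unset Printing Implicit Defensive.

Local Open Scope classical_set_scope.
Local Open Scope ring_scope.
Local Open Scope complex_scope.

(* The regular algebra [R[i]^o] is the copy of [R[i]] on which the topology
   and the complex normed space structure are inferred. *)
Notation CC R := ((complex R)^o).

Definition plane_to_C (R : realType) (p : R * R) : CC R := p.1 +i* p.2.
Definition C_to_plane (R : realType) (z : CC R) : R * R :=
  (complex.Re z, complex.Im z).

Definition boundary (T : topologicalType) (A : set T) : set T :=
  closure A `\` interior A.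

Definition holomorphic_on (R : realType) (Omega : set (CC R))
    (f : CC R -> CC R) : Prop :=
  forall z, Omega z -> derivable f z (1 : CC R).

Definition nonconstant_on (T V : Type) (A : set T) (f : T -> V) : Prop :=
  ~ exists c, forall x, A x -> f x = c.

Definition re_part (R : realType) (u : CC R -> CC R) (p : R * R) : R :=
  complex.Re (u (plane_to_C p)).
Definition im_part (R : realType) (u : CC R -> CC R) (p : R * R) : R :=
  complex.Im (u (plane_to_C p)).

Definition e1 (R : realType) : R * R := (1, 0).
Definition e2 (R : realType) : R * R := (0, 1).

(* To be used with [W] open: [f] has all its partial derivatives of order
   at most [k] on [W], and they are continuous there. *)
Fixpoint Ck_on (R : realType) (k : nat) (W : set (R * R)) (f : R * R -> R)
    : Prop :=
  (forall p, W p -> {for p, continuous f}) /\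
  if k is k'.+1 then
    [/\ forall p, W p -> derivable f p (e1 R) /\ derivable f p (e2 R),
        Ck_on k' W ('D_(e1 R) f) &
        Ck_on k' W ('D_(e2 R) f)]
  else True.

Definition smooth_on (R : realType) (W : set (CC R)) (u : CC R -> CC R)
    : Prop :=
  forall k, Ck_on k (@plane_to_C R @^-1` W) (re_part u) /\
            Ck_on k (@plane_to_C R @^-1` W) (im_part u).

(* Only the values of [f] on [Omega] and of [u] on [Omega `|` N] matter. *)
Definition smooth_extension_across (R : realType) (Omega : set (CC R))
    (z0 : CC R) (f : CC R -> CC R) (N : set (CC R)) (u : CC R -> CC R)
    : Prop :=
  [/\ open N, N z0, smooth_on (Omega `|` N) u &
      forall z, Omega z -> u z = f z].

Definition partial_C (R : realType) (v : R * R) (u : CC R -> CC R) (z : CC R)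
    : CC R :=
  'D_v (re_part u) (C_to_plane z) +i* 'D_v (im_part u) (C_to_plane z).

Definition dbar (R : realType) (u : CC R -> CC R) (z : CC R) : CC R :=
  2%:R^-1 * (partial_C (e1 R) u z + 'i%C * partial_C (e2 R) u z).

Definition del (R : realType) (u : CC R -> CC R) (z : CC R) : CC R :=
  2%:R^-1 * (partial_C (e1 R) u z - 'i%C * partial_C (e2 R) u z).

(* The norm `|z| of a complex number is itself in [R[i]]; this is its value
   in [R]. *)
Definition absC (R : realType) (z : CC R) : R := complex.Re `|z|.

Definition area_integral (R : realType) (A : set (CC R)) (f : CC R -> R)
    : \bar R :=
  (\int[@lebesgue_measure R \x @lebesgue_measure R]_(p in
     @plane_to_C R @^-1` A) (f (plane_to_C p))%:E)%E.

Definition sq_quotient (R : realType) (g u : CC R -> CC R) (z : CC R) : R :=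
  if u z == 0 then 0 else absC (g z) ^+ 2 / absC (u z) ^+ 2.

Definition disc (R : realType) (z0 : CC R) (r : R) : set (CC R) :=
  [set z | absC (z - z0) < r].

Definition vanishes_to_infinite_order (R : realType) (u : CC R -> CC R)
    (z0 : CC R) : Prop :=
  forall m : nat,
    ((r ^- m)%:E * area_integral (disc z0 r) (fun z => (absC (u z) ^+ 2)%R))%E
      @[r --> (0 : R)^'+] --> 0%E.

Definition vanishes_to_finite_order (R : realType) (u : CC R -> CC R)
    (z0 : CC R) : Prop :=
  ~ vanishes_to_infinite_order u z0.

(* Main.v *)
(** Write u = a + i b. Since dbar u vanishes on Omega and z0 is a limit point of
    Omega, dbar u vanishes at z0 together with all its derivatives, so that either
    u = c (z - z0)^k + O(|z - z0|^(k+1)) with c <> 0 and k >= 1, or u is flat at z0.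
    In the first case dbar u / u is bounded near z0, whereas |del u|^2 / |u|^2 is
    comparable to |z - z0|^-2, which is not integrable.

    In the flat case suppose that Q = |dbar u|^2 / |u|^2 is integrable near z0. With
    h = M log (|z - z0|^2 + tau^2), g = e^h and P = |u|^2 + g one has
<<
    Laplacian (ln P) = 4 g |del u - u del h|^2 / P^2 - 4 g |dbar u|^2 / P^2
                       + (g / P) Laplacian h + 8 Re del (conj u dbar u / P).
>>
    Integrate this against a bump function psi that is subharmonic outside a small
    neighbourhood of a point close to z0 where u does not vanish. The first term is
    nonnegative; the second, the fourth and the integral of ln P times the Laplacian
    of psi are bounded, uniformly in M and tau, in terms of the integral of Q. The
    third is at least of order M psi(z0), because P <= 2 g near z0 for small tau, u
    being flat. As M is arbitrary, u vanishes near z0. The same argument applies at the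
    points of Omega, where dbar u = 0, so the interior of the zero set of u is both
    open and closed in Omega; hence f is zero on Omega, which is excluded. *)
Require Import Defs.
From mathcomp Require Import measurable_realfun ring lra.

Set Implicit Arguments.
Unset Strict Implicit.
Unset Printing Implicit Defensive.

Local Open Scope classical_set_scope.
Local Open Scope ring_scope.

(** Putting g next to |u|^2 under the logarithm keeps every error at the level of Q: since 4 g |u|^2
    <= P^2, the term 4 g |dbar u|^2 / P^2 is at most Q for all M and tau, and the term in divergence
    form, moved onto psi by parts, is at most |grad psi|^2 + 4 Q. As for ln P, it has a uniform
    upper bound, but a uniform lower bound only where u stays away from 0; this is why psi must be
    subharmonic everywhere else. The order of the choices is essential: psi and the bound K, then M,
    then the constants of flatness to an order depending on M, and tau last.

    Squares and products of one-variable profiles are used because on them the divergence theorem is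
    Fubini and the fundamental theorem of calculus in each variable.

    The alternative between a leading term and flatness uses no Taylor formula: x-derivatives of u
    still satisfy the Cauchy-Riemann equations on Omega, and one integration along the axes raises
    the order by one. *)

Notation lam2 R := (@lebesgue_measure R \x @lebesgue_measure R)%E.

(** * Boxes: measurability, and integrals of derivatives over them *)

Definition box (R : realType) (a b c d : R) : set (R * R) :=
  `[a, b]%classic `*` `[c, d]%classic.

Lemma boxP (R : realType) (a b c d : R) (p : R * R) :
  box a b c d p <-> (a <= p.1 <= b) /\ (c <= p.2 <= d).
Proof. by rewrite /box /= !in_itv /=. Qed.

Lemma measurable_box (R : realType) (a b c d : R) : measurable (box a b c d).
Proof. exact: measurableX. Qed.

Lemma lam2_box (R : realType) (a b c d : R) : a <= b -> c <= d ->
  lam2 R (box a b c d) = ((b - a) * (d - c))%:E.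
Proof.
rewrite /box product_measure1E//= !lebesgue_measure_itv/= !lte_fin.
rewrite le_eqVlt => /orP[/eqP->|ab]; first by rewrite ltxx subrr mul0e mul0r.
rewrite le_eqVlt => /orP[/eqP->|cd]; first by rewrite ltxx subrr mule0 mulr0.
by rewrite ab cd -!EFinB -EFinM.
Qed.

Lemma nbhs_pairP (R : realType) (p : R * R) (A : set (R * R)) :
  nbhs p A <->
  exists2 e : R, 0 < e & forall q : R * R, `|q.1 - p.1| < e -> `|q.2 - p.2| < e -> A q.
Proof.
split=> [/nbhs_ballP[e /= e0 eA]|[e e0 eA]].
  exists e => // q q1 q2; apply: eA; split; rewrite /= -ball_normE /= distrC//.
apply/nbhs_ballP; exists e => //= q [/= q1 q2].
by apply: eA; rewrite distrC; [move: q1|move: q2]; rewrite -ball_normE.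
Qed.

(** The measurable structure on [R * R] is the product one, so the open set is written as the
    countable union of the rational boxes that it contains. *)
Lemma open2_measurable (R : realType) (A : set (R * R)) : open A -> measurable A.
Proof.
move=> oA.
pose B (q : (rat * rat) * (rat * rat)) : set (R * R) :=
  `]ratr q.1.1, ratr q.1.2[%classic `*` `]ratr q.2.1, ratr q.2.2[%classic.
have -> : A = \bigcup_q (if `[< B q `<=` A >] then B q else set0).
  apply/seteqP; split=> [p Ap|p [q _]]; last by case: asboolP => // qA /qA.
  have /nbhs_pairP[e e0 eA] : nbhs p A by exact: open_nbhs_nbhs.
  have [|q1] := @rat_in_itvoo R (p.1 - e) p.1; first by lra.
  rewrite in_itv/= => /andP[a1 b1].
  have [|q2] := @rat_in_itvoo R p.1 (p.1 + e); first by lra.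
  rewrite in_itv/= => /andP[a2 b2].
  have [|q3] := @rat_in_itvoo R (p.2 - e) p.2; first by lra.
  rewrite in_itv/= => /andP[a3 b3].
  have [|q4] := @rat_in_itvoo R p.2 (p.2 + e); first by lra.
  rewrite in_itv/= => /andP[a4 b4].
  exists ((q1, q2), (q3, q4)) => //.
  case: asboolP => [_|[]]; first by split; rewrite /= in_itv /=; apply/andP.
  move=> r [/=]; rewrite !in_itv /= => /andP[c1 c2] /andP[c3 c4].
  by apply: eA; rewrite ltr_norml; lra.
apply: countable_bigcupT_measurable => // q; case: ifP => // _; exact: measurableX.
Qed.

Lemma open2_continuous_measurable_fun (R : realType) (W : set (R * R)) (f : R * R -> R) :
  open W -> (forall p, W p -> {for p, continuous f}) -> measurable_fun W f.
Proof.
move=> oW cf; apply: (measurability _ (RGenOpens.measurableE R)).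
move=> _ [_ [a [b ->] <-]]; apply: open2_measurable.
rewrite openE => p [Wp fp]; apply: filterI; first exact: open_nbhs_nbhs.
by apply: cf => //; apply: open_nbhs_nbhs; split => //; exact: interval_open.
Qed.

Lemma compact_box (R : realType) (a b c d : R) : compact (box a b c d).
Proof. by apply: compact_setX; exact: segment_compact. Qed.

Lemma continuous_box_bounded (R : realType) (a b c d : R) (f : R * R -> R) :
  (forall p, box a b c d p -> {for p, continuous f}) ->
  exists2 M, 0 < M & forall p, box a b c d p -> `|f p| <= M.
Proof.
move=> cf.
have : {within box a b c d, continuous f}.
  by apply: continuous_in_subspaceT => p /[!inE]; exact: cf.
move=> /continuous_compact/(_ (@compact_box R a b c d))/compact_bounded.
move=> /ex_strict_bound_gt0[M M0 fM]; exists M => // p Bp.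
by apply/ltW/fM; exists p.
Qed.

Lemma lam2_box_lty (R : realType) (a b c d : R) : (lam2 R (box a b c d) < +oo)%E.
Proof.
have [ab|ba] := leP a b; last first.
  rewrite (_ : box a b c d = set0) ?measure0 ?ltry// -subset0 => p /boxP[+ _] /=; lra.
have [cd|dc] := leP c d; last first.
  rewrite (_ : box a b c d = set0) ?measure0 ?ltry// -subset0 => p /boxP[_] /=; lra.
by rewrite lam2_box// ltry.
Qed.

Lemma continuous_box_integrable (R : realType) (a b c d : R) (W : set (R * R)) (f : R * R -> R) :
  open W -> box a b c d `<=` W ->
  (forall p, W p -> {for p, continuous f}) ->
  (lam2 R).-integrable (box a b c d) (EFin \o f).
Proof.
move=> oW BW cf; apply: measurable_bounded_integrable.
- exact: measurable_box.
- exact: lam2_box_lty.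
- apply: measurable_funS (open2_continuous_measurable_fun oW cf) => //.
  exact: open2_measurable.
- have [|M M0 fM] := @continuous_box_bounded R a b c d f; first by move=> p /BW; exact: cf.
  by exists M; split => [|x Mx p Bp]; [exact: num_real|exact: le_trans (fM _ Bp) (ltW Mx)].
Qed.

(** Extension by zero lets Fubini be used on the whole plane; a horizontal slice then has either the
    integral of the hypothesis or the zero function. *)
Lemma integrable_int_box (R : realType) (a b c d : R) (f : R * R -> R) :
  (lam2 R).-integrable (box a b c d) (EFin \o f) ->
  (forall y, c <= y <= d ->
     (\int[lebesgue_measure]_(x in `[a, b]) (f (x, y))%:E = 0)%E) ->
  (\int[lam2 R]_(p in box a b c d) (f p)%:E = 0)%E.
Proof.
move=> fi f0; rewrite integral_mkcond.
rewrite -integral21_prod_meas1; last first.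
  by have/integrable_mkcond := fi; apply => //; exact: measurable_box.
rewrite /fubini_G integral0_eq// => y _.
have [yc|yc] := boolP (c <= y <= d).
  rewrite -[RHS](f0 _ yc) [RHS]integral_mkcond; apply: eq_integral => x _.
  rewrite !patchE; have [xa|xa] := boolP (x \in `[a, b]%classic).
    by rewrite mem_set//; apply/boxP => /=; split=> //; move: xa; rewrite inE/= in_itv.
  rewrite memNset// => /boxP[/= ax _]; move: xa; rewrite notin_setE/= in_itv/=; exact.
rewrite integral0_eq// => x _; rewrite patchE memNset// => /boxP[_ /= cy].
by rewrite cy in yc.
Qed.

Lemma integrable_int_box_y (R : realType) (a b c d : R) (f : R * R -> R) :
  (lam2 R).-integrable (box a b c d) (EFin \o f) ->
  (forall x, a <= x <= b ->
     (\int[lebesgue_measure]_(y in `[c, d]) (f (x, y))%:E = 0)%E) ->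
  (\int[lam2 R]_(p in box a b c d) (f p)%:E = 0)%E.
Proof.
move=> fi f0; rewrite integral_mkcond.
rewrite -integral12_prod_meas1; last first.
  by have/integrable_mkcond := fi; apply => //; exact: measurable_box.
rewrite /fubini_F integral0_eq// => x _.
have [xc|xc] := boolP (a <= x <= b).
  rewrite -[RHS](f0 _ xc) [RHS]integral_mkcond; apply: eq_integral => y _.
  rewrite !patchE; have [ya|ya] := boolP (y \in `[c, d]%classic).
    by rewrite mem_set//; apply/boxP => /=; split=> //; move: ya; rewrite inE/= in_itv.
  rewrite memNset// => /boxP[/= _ ay]; move: ya; rewrite notin_setE/= in_itv/=; exact.
rewrite integral0_eq// => y _; rewrite patchE memNset// => /boxP[/= ax _].
by rewrite ax in xc.
Qed.

Lemma FTC2_vanishing_ends (R : realType) (a b : R) (f df : R -> R) : a < b ->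
  (forall x, a <= x <= b -> is_derive x 1 f (df x)) ->
  (forall x, a <= x <= b -> {for x, continuous df}) ->
  f a = 0 -> f b = 0 ->
  (\int[lebesgue_measure]_(x in `[a, b]) (df x)%:E = 0)%E.
Proof.
move=> ab fd dfc fa fb.
have fc x : a <= x <= b -> {for x, continuous f}.
  by move=> /fd [+ _] => /derivable1_diffP/differentiable_continuous.
rewrite (@continuous_FTC2 _ _ f) ?fa ?fb ?subee//.
- apply: continuous_in_subspaceT => x; rewrite inE/= in_itv/=; exact: dfc.
- split.
  + by move=> x; rewrite in_itv/= => /andP[ax xb]; have [] := fd x; rewrite ?ltW.
  + by apply: cvg_at_right_filter; apply: fc; rewrite lexx ltW.
  + by apply: cvg_at_left_filter; apply: fc; rewrite lexx ltW.
- move=> x; rewrite in_itv/= => /andP[ax xb]; rewrite derive1E.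
  have axb : a <= x <= b by rewrite !ltW.
  by have [_ ->] := fd x axb.
Qed.

Lemma continuous_pair_x (R : realType) (f : R * R -> R) (x y : R) :
  {for (x, y), continuous f} -> {for x, continuous (fun t => f (t, y))}.
Proof.
move=> fc; apply: (@continuous_comp _ _ _ (fun t => (t, y)) f) => //.
by apply: (@cvg_pair _ _ _ (nbhs x) (nbhs x) (nbhs y)); [exact: cvg_id|exact: cvg_cst].
Qed.

Lemma continuous_pair_y (R : realType) (f : R * R -> R) (x y : R) :
  {for (x, y), continuous f} -> {for y, continuous (fun t => f (x, t))}.
Proof.
move=> fc; apply: (@continuous_comp _ _ _ (fun t => (x, t)) f) => //.
by apply: (@cvg_pair _ _ _ (nbhs y) (nbhs x) (nbhs y)); [exact: cvg_cst|exact: cvg_id].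
Qed.

(** The horizontal half of the divergence theorem, for a component that vanishes on the vertical
    sides. *)
Lemma int_box_dx (R : realType) (a b c d : R) (W : set (R * R)) (X D : R * R -> R) :
  a < b -> open W -> box a b c d `<=` W ->
  (forall p, W p -> {for p, continuous D}) ->
  (forall x y, W (x, y) -> is_derive x 1 (fun t => X (t, y)) (D (x, y))) ->
  (forall y, c <= y <= d -> X (a, y) = 0 /\ X (b, y) = 0) ->
  (\int[lam2 R]_(p in box a b c d) (D p)%:E = 0)%E.
Proof.
move=> ab oW BW Dc XD X0; apply: integrable_int_box.
  exact: continuous_box_integrable Dc.
move=> y yc; have [Xa Xb] := X0 y yc.
apply: (@FTC2_vanishing_ends _ _ _ (fun t => X (t, y)) (fun t => D (t, y))) => // x xab.
  by apply: XD; apply: BW; apply/boxP.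
by apply/continuous_pair_x/Dc/BW/boxP.
Qed.

Lemma int_box_dy (R : realType) (a b c d : R) (W : set (R * R)) (X D : R * R -> R) :
  c < d -> open W -> box a b c d `<=` W ->
  (forall p, W p -> {for p, continuous D}) ->
  (forall x y, W (x, y) -> is_derive y 1 (fun t => X (x, t)) (D (x, y))) ->
  (forall x, a <= x <= b -> X (x, c) = 0 /\ X (x, d) = 0) ->
  (\int[lam2 R]_(p in box a b c d) (D p)%:E = 0)%E.
Proof.
move=> ab oW BW Dc XD X0; apply: integrable_int_box_y.
  exact: continuous_box_integrable Dc.
move=> x xc; have [Xa Xb] := X0 x xc.
apply: (@FTC2_vanishing_ends _ _ _ (fun t => X (x, t)) (fun t => D (x, t))) => // y ycd.
  by apply: XD; apply: BW; apply/boxP.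
by apply/continuous_pair_y/Dc/BW/boxP.
Qed.

(** * Zeros with nonvanishing partial derivative form a null set *)

Lemma isolated_zero (R : realType) (f : R -> R) (x d : R) :
  is_derive x 1 f d -> d != 0 -> f x = 0 ->
  exists2 e : R, 0 < e & forall y, `|y - x| < e -> f y = 0 -> y = x.
Proof.
move=> [fx fd] d0 fx0.
have : (fun h => h^-1 *: (f (h *: 1 + x) - f x)) @ 0^' --> d by rewrite -fd; exact: fx.
move=> /cvgr_neq0 /(_ d0) [e /= e0 He]; exists e => // y yx fy.
apply/eqP/negPn/negP => yx0.
have /= := He (y - x); rewrite sub0r normrN => /(_ yx).
rewrite subr_eq0 => /(_ yx0); rewrite [_ *: 1]mulr1 subrK fy fx0 subrr scaler0.
by rewrite eqxx.
Qed.

(** Simple zeros are isolated, so each one is the only zero in some interval with rational end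
    points, and such intervals are countable. *)
Lemma countable_simple_zeros (R : realType) (f : R -> R) :
  countable [set x | f x = 0 /\ exists2 d, d != 0 & is_derive x 1 f d].
Proof.
pose A (q : rat * rat) := [set x | [/\ ratr q.1 < x < ratr q.2, f x = 0 &
   forall y, ratr q.1 < y < ratr q.2 -> f y = 0 -> y = x]].
apply: (@sub_countable _ _ _ (\bigcup_q A q)).
  apply: subset_card_le => x [fx0 [d d0 fd]].
  have [e e0 He] := isolated_zero fd d0 fx0.
  have [|q1] := @rat_in_itvoo R (x - e) x; first by lra.
  rewrite in_itv/= => /andP[a1 b1].
  have [|q2] := @rat_in_itvoo R x (x + e); first by lra.
  rewrite in_itv/= => /andP[a2 b2].
  exists (q1, q2) => //; split => //=; first by rewrite b1 a2.
  by move=> y /andP[y1 y2]; apply: He; rewrite ltr_norml; lra.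
apply: bigcup_countable => // q _.
have [->|/set0P[x [xq fx xu]]] := eqVneq (A q) set0; first exact: countable0.
apply: (@sub_countable _ _ _ [set x]); last exact: countable1.
by apply: subset_card_le => y [yq fy _]; rewrite /= (xu y).
Qed.

Lemma measurable_zero_neq0 (R : realType) (W : set (R * R)) (f g : R * R -> R) :
  open W -> (forall p, W p -> {for p, continuous f}) ->
  (forall p, W p -> {for p, continuous g}) ->
  measurable [set p | [/\ W p, f p = 0 & g p != 0]].
Proof.
move=> oW fc gc.
have H (h : R * R -> R) : (forall p, W p -> {for p, continuous h}) ->
    measurable [set p | W p /\ h p != 0].
  move=> hc; apply: open2_measurable; rewrite openE => p [Wp hp].
  apply: filterI; first exact: open_nbhs_nbhs.
  exact: (cvgr_neq0 _ (hc _ Wp) hp).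
rewrite (_ : [set p | _] = [set p | W p /\ g p != 0] `\` [set p | W p /\ f p != 0]).
  by apply: measurableD; exact: H.
apply/seteqP; split=> p /=; first by move=> [Wp fp gp]; split=> // -[_]; rewrite fp eqxx.
by move=> [[Wp gp] nf]; split => //; apply/eqP/negPn/negP => fp; exact: nf.
Qed.

Lemma lam2_xsection0 (R : realType) (A : set (R * R)) : measurable A ->
  (forall x, countable (xsection A x)) -> lam2 R A = 0%E.
Proof.
move=> mA cA; rewrite /product_measure1 integral0_eq// => x _.
exact: countable_lebesgue_measure0.
Qed.

Lemma lam2_ysection0 (R : realType) (A : set (R * R)) : measurable A ->
  (forall y, countable (ysection A y)) -> lam2 R A = 0%E.
Proof.
move=> mA cA.
(* [lam2] is defined through vertical sections; by uniqueness it equals the measure defined through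
   horizontal ones. *)
rewrite (@product_measure_unique _ _ _ _ _ _ _ (lebesgue_measure \x^ lebesgue_measure)%E)//.
  rewrite /= /product_measure2 integral0_eq// => y _.
  exact: countable_lebesgue_measure0.
by move=> ? ? ? ?; rewrite /= product_measure2E.
Qed.

(** A horizontal line meets the set in simple zeros of a function of one variable, hence in a
    countable set. *)
Lemma lam2_simple_zeros_x (R : realType) (W : set (R * R)) (f g : R * R -> R) :
  open W -> (forall p, W p -> {for p, continuous f}) ->
  (forall p, W p -> {for p, continuous g}) ->
  (forall x y, W (x, y) -> is_derive x 1 (fun t => f (t, y)) (g (x, y))) ->
  (lam2 R).-negligible [set p | [/\ W p, f p = 0 & g p != 0]].
Proof.
move=> oW fc gc fg; have mA := measurable_zero_neq0 oW fc gc.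
apply/negligibleP => //; apply: lam2_ysection0 => // y.
apply: (@sub_countable _ _ _ _ _ (countable_simple_zeros (fun t => f (t, y)))).
apply: subset_card_le => x; rewrite /ysection/= inE/= => -[Wp fp gp]; split => //.
by exists (g (x, y)) => //; exact: fg.
Qed.

Lemma lam2_simple_zeros_y (R : realType) (W : set (R * R)) (f g : R * R -> R) :
  open W -> (forall p, W p -> {for p, continuous f}) ->
  (forall p, W p -> {for p, continuous g}) ->
  (forall x y, W (x, y) -> is_derive y 1 (fun t => f (x, t)) (g (x, y))) ->
  (lam2 R).-negligible [set p | [/\ W p, f p = 0 & g p != 0]].
Proof.
move=> oW fc gc fg; have mA := measurable_zero_neq0 oW fc gc.
apply/negligibleP => //; apply: lam2_xsection0 => // x.
apply: (@sub_countable _ _ _ _ _ (countable_simple_zeros (fun t => f (x, t)))).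
apply: subset_card_le => y; rewrite /xsection/= inE/= => -[Wp fp gp]; split => //.
by exists (g (x, y)) => //; exact: fg.
Qed.

(** * Derivatives of one-variable functions and mean value estimates *)

Section derive_rules.
Context {R : realType}.
Implicit Types (f g : R -> R) (x df dg c : R).

Lemma is_der_cst c x : is_derive x 1 (fun _ : R => c) 0.
Proof. exact: is_derive_cst. Qed.

Lemma is_der_id x : is_derive x 1 (fun t : R => t) 1.
Proof. exact: is_derive_id. Qed.

Lemma is_der_eq f x df dg : is_derive x 1 f df -> df = dg -> is_derive x 1 f dg.
Proof. by move=> ? <-. Qed.

Lemma is_derD f g x df dg : is_derive x 1 f df -> is_derive x 1 g dg ->
  is_derive x 1 (fun t => f t + g t) (df + dg).
Proof. by move=> fd gd; exact: is_deriveD. Qed.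

Lemma is_derB f g x df dg : is_derive x 1 f df -> is_derive x 1 g dg ->
  is_derive x 1 (fun t => f t - g t) (df - dg).
Proof. by move=> fd gd; exact: is_deriveB. Qed.

Lemma is_derM f g x df dg : is_derive x 1 f df -> is_derive x 1 g dg ->
  is_derive x 1 (fun t => f t * g t) (df * g x + f x * dg).
Proof.
move=> fd gd; refine (is_der_eq (is_deriveM fd gd) _).
by rewrite addrC -![_ *: _]/(_ * _); congr (_ + _); rewrite mulrC.
Qed.

Lemma is_derX f x df n : is_derive x 1 f df ->
  is_derive x 1 (fun t => f t ^+ n) (n%:R * f x ^+ n.-1 * df).
Proof.
move=> fd; elim: n => [|[|n] IH].
- by rewrite !mul0r; exact: is_der_cst.
- by rewrite expr0 !mul1r.
- have -> : (fun t => f t ^+ n.+2) = (fun t => f t ^+ n.+1 * f t).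
    by apply/funext => t; rewrite exprSr.
  refine (is_der_eq (is_derM IH fd) _).
  by rewrite /= -[in LHS]natr1 exprS; ring.
Qed.

Lemma is_derV f x df : f x != 0 -> is_derive x 1 f df ->
  is_derive x 1 (fun t => (f t)^-1) (- df / f x ^+ 2).
Proof.
move=> fx0 fd; refine (is_der_eq (is_deriveV fx0 fd) _).
by rewrite -[_ *: _]/(_ * _) mulNr [RHS]mulNr mulrC.
Qed.

Lemma is_der_div f g x df dg : g x != 0 -> is_derive x 1 f df -> is_derive x 1 g dg ->
  is_derive x 1 (fun t => f t / g t) ((df * g x - f x * dg) / g x ^+ 2).
Proof.
move=> gx0 fd gd; refine (is_der_eq (is_derM fd (is_derV gx0 gd)) _).
by field.
Qed.

Lemma is_der_ln f x df : 0 < f x -> is_derive x 1 f df ->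
  is_derive x 1 (fun t => ln (f t)) (df / f x).
Proof.
move=> fx0 fd.
have ld := is_derive1_ln fx0.
refine (is_der_eq (is_derive1_comp ld fd) _).
by rewrite mulrC.
Qed.

Lemma is_der_continuous f x df : is_derive x 1 f df -> {for x, continuous f}.
Proof. by move=> [/derivable1_diffP/differentiable_continuous]. Qed.

Lemma mean_value f (df : R -> R) (a b : R) : a <= b ->
  (forall x, a <= x <= b -> is_derive x 1 f (df x)) ->
  exists2 c, a <= c <= b & f b - f a = df c * (b - a).
Proof.
move=> ab fd; have [||c] := @MVT_segment R f df a b ab.
- by move=> x; rewrite in_itv/= => /andP[xa xb]; apply: fd; rewrite !ltW.
- apply: continuous_in_subspaceT => x; rewrite inE/= in_itv/= => xab.
  exact: is_der_continuous (fd _ xab).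
- by rewrite in_itv/= => *; exists c.
Qed.

(** The hypothesis is symmetric about [a], which spares its users a case distinction on the side
    where [b] lies. *)
Lemma mean_value_le f (df : R -> R) (a b C : R) :
  (forall x, `|x - a| <= `|b - a| -> is_derive x 1 f (df x) /\ `|df x| <= C) ->
  `|f b - f a| <= C * `|b - a|.
Proof.
move=> H; have [ab|/ltW ba] := leP a b.
  have [|c cab ->] := @mean_value f df a b ab.
    by move=> x xab; apply: (H x _).1; rewrite !ger0_norm; lra.
  by rewrite normrM ler_wpM2r//; apply: (H c _).2; rewrite !ger0_norm; lra.
rewrite distrC; have [|c cab ->] := @mean_value f df b a ba.
  by move=> x xab; apply: (H x _).1; rewrite !ler0_norm; lra.
rewrite normrM [`|b - a|]distrC ler_wpM2r//; apply: (H c _).2.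
by rewrite !ler0_norm; lra.
Qed.

End derive_rules.

(** * Mixed partial derivatives, pointwise divergence inequalities, the bump *)

Lemma below_both (R : realFieldType) (a b : R) : 0 < a -> 0 < b ->
  exists h, [/\ 0 < h, h < a & h < b].
Proof.
move=> a0 b0; have [ab|ba] := leP a b; [exists (a / 2)|exists (b / 2)]; split; lra.
Qed.

Lemma continuous_pairP (R : realType) (f : R * R -> R) (p : R * R) (e : R) :
  {for p, continuous f} -> 0 < e -> exists2 d : R, 0 < d &
    forall q : R * R, `|q.1 - p.1| < d -> `|q.2 - p.2| < d -> `|f q - f p| < e.
Proof.
move=> fc e0; have /cvgr_distC_lt/(_ _ e0) : f @ p --> f p := fc.
by move=> /nbhs_pairP[d d0 H]; exists d.
Qed.

(** The second difference of [f] over a square of side h is h^2 times a value of [fxy], and also h^2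
    times a value of [fyx]. For small h both are within e / 2 of the values at [p]. *)
Lemma mixed_partials (R : realType) (W : set (R * R)) (f fx fy fxy fyx : R * R -> R) p :
  open W -> W p ->
  (forall x y, W (x, y) -> is_derive x 1 (fun t => f (t, y)) (fx (x, y))) ->
  (forall x y, W (x, y) -> is_derive y 1 (fun t => f (x, t)) (fy (x, y))) ->
  (forall x y, W (x, y) -> is_derive y 1 (fun t => fx (x, t)) (fxy (x, y))) ->
  (forall x y, W (x, y) -> is_derive x 1 (fun t => fy (t, y)) (fyx (x, y))) ->
  {for p, continuous fxy} -> {for p, continuous fyx} -> fxy p = fyx p.
Proof.
case: p => x y oW Wp fxP fyP fxyP fyxP c1 c2.
apply/eqP; rewrite -subr_eq0 -normr_le0.
apply/ler_addgt0Pr => e e0; rewrite add0r.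
have e2 : 0 < e / 2 by lra.
have /nbhs_pairP[r1 r10 H1] : nbhs (x, y) W by exact: open_nbhs_nbhs.
have [r2 r20 H2] := continuous_pairP c1 e2.
have [r3 r30 H3] := continuous_pairP c2 e2.
have [h' [h'0 hr1' hr2']] := below_both r10 r20.
have [h [h0 hh' hr3]] := below_both h'0 r30.
have HW s t : x <= s <= x + h -> y <= t <= y + h -> W (s, t).
  by move=> ? ?; apply: H1 => /=; rewrite ger0_norm; lra.
have [||s s1 E1] := @mean_value _ (fun t => f (t, y + h) - f (t, y))
    (fun t => fx (t, y + h) - fx (t, y)) x (x + h).
- lra.
- by move=> s sx; apply: is_derB; apply: fxP; apply: HW => //; lra.
have [||t t1 E2] := @mean_value _ (fun t => fx (s, t)) (fun t => fxy (s, t)) y (y + h).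
- lra.
- by move=> t ty; apply: fxyP; apply: HW.
have [||t' t1' E1'] := @mean_value _ (fun t => f (x + h, t) - f (x, t))
    (fun t => fy (x + h, t) - fy (x, t)) y (y + h).
- lra.
- by move=> t' ty; apply: is_derB; apply: fyP; apply: HW => //; lra.
have [||s' s1' E2'] := @mean_value _ (fun s => fy (s, t')) (fun s => fyx (s, t')) x (x + h).
- lra.
- by move=> s' sx; apply: fyxP; apply: HW.
have E : fxy (s, t) = fyx (s', t').
  rewrite E2 in E1; rewrite E2' in E1'.
  have hh : h * h != 0 by rewrite mulf_neq0// gt_eqF.
  by apply: (mulIf hh); lra.
have A1 : `|fxy (s, t) - fxy (x, y)| < e / 2 by apply: H2 => /=; rewrite ger0_norm; lra.
have A2 : `|fyx (s', t') - fyx (x, y)| < e / 2 by apply: H3 => /=; rewrite ger0_norm; lra.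
move: A1 A2; rewrite E !ltr_norml ler_norml; lra.
Qed.

(** With u = a + i b, the left side is g p^2 div (F / p). The first two squares add up to 4 |g del u
    - u del g|^2, the subtracted term is 4 g^2 |dbar u|^2, and the last bracket is g^2 Laplacian (ln
    g). The derivatives [axy] and [bxy] cancel between [F1x] and [F2y]. *)
Lemma divergence_identity (R : realFieldType)
    (a ax ay axy b bx bY bxy g gx gy gxx gyy : R) :
  let p := a ^+ 2 + b ^+ 2 + g in
  let px := 2 * a * ax + 2 * b * bx + gx in
  let py := 2 * a * ay + 2 * b * bY + gy in
  let F1 := 2 * (a * bY - b * ay) + gx in
  let F2 := - 2 * (a * bx - b * ax) + gy in
  let F1x := 2 * (ax * bY + a * bxy - bx * ay - b * axy) + gxx in
  let F2y := - 2 * (ay * bx + a * bxy - bY * ax - b * axy) + gyy in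
  g * ((F1x * p - F1 * px) + (F2y * p - F2 * py)) =
  (g * (ax + bY) - (a * gx + b * gy)) ^+ 2 + (g * (bx - ay) - (b * gx - a * gy)) ^+ 2
  - g ^+ 2 * ((ax - bY) ^+ 2 + (bx + ay) ^+ 2)
  + p * (g * (gxx + gyy) - gx ^+ 2 - gy ^+ 2).
Proof. by move=> /=; ring. Qed.

(** The squares in [divergence_identity] are dropped, and p^2 - 4 g |u|^2 = (|u|^2 - g)^2 >= 0
    bounds the term in dbar u by [Q], independently of [g]. *)
Lemma divergence_lower (R : realFieldType)
    (a ax ay axy b bx bY bxy g gx gy gxx gyy Q : R) :
  0 < g -> 0 <= Q ->
  (ax - bY) ^+ 2 + (bx + ay) ^+ 2 = 4 * Q * (a ^+ 2 + b ^+ 2) ->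
  let p := a ^+ 2 + b ^+ 2 + g in
  let px := 2 * a * ax + 2 * b * bx + gx in
  let py := 2 * a * ay + 2 * b * bY + gy in
  let F1 := 2 * (a * bY - b * ay) + gx in
  let F2 := - 2 * (a * bx - b * ax) + gy in
  let F1x := 2 * (ax * bY + a * bxy - bx * ay - b * axy) + gxx in
  let F2y := - 2 * (ay * bx + a * bxy - bY * ax - b * axy) + gyy in
  is_true ((g * (gxx + gyy) - gx ^+ 2 - gy ^+ 2) / (g * p) - Q <=
           (F1x * p - F1 * px) / p ^+ 2 + (F2y * p - F2 * py) / p ^+ 2).
Proof.
move=> g0 Q0 S p px py F1 F2 F1x F2y.
have u0 : 0 <= a ^+ 2 + b ^+ 2 by rewrite addr_ge0 ?sqr_ge0.
have p0 : 0 < p by rewrite ltr_wpDl.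
have gp0 : 0 < g * p ^+ 2 by rewrite mulr_gt0 ?exprn_gt0.
rewrite -mulrDl -(ler_pM2l gp0).
have -> : g * p ^+ 2 * ((F1x * p - F1 * px + (F2y * p - F2 * py)) / p ^+ 2) =
  g * (F1x * p - F1 * px + (F2y * p - F2 * py)) by field; rewrite gt_eqF.
have -> : g * p ^+ 2 * ((g * (gxx + gyy) - gx ^+ 2 - gy ^+ 2) / (g * p) - Q) =
  p * (g * (gxx + gyy) - gx ^+ 2 - gy ^+ 2) - g * p ^+ 2 * Q.
  by field; rewrite !gt_eqF.
rewrite divergence_identity S -/p.
set E1 := (_ - _) ^+ 2; set E2 := (_ - _) ^+ 2.
have E10 : 0 <= E1 by exact: sqr_ge0.
have E20 : 0 <= E2 by exact: sqr_ge0.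
suff : g ^+ 2 * (4 * Q * (a ^+ 2 + b ^+ 2)) <= g * p ^+ 2 * Q by lra.
rewrite (_ : g * p ^+ 2 * Q = (g * Q) * p ^+ 2); last by ring.
rewrite (_ : g ^+ 2 * _ = (g * Q) * (4 * g * (a ^+ 2 + b ^+ 2))); last by ring.
apply: ler_wpM2l; first by rewrite mulr_ge0 ?(ltW g0).
rewrite -subr_ge0.
rewrite (_ : _ - _ = (a ^+ 2 + b ^+ 2 - g) ^+ 2) ?sqr_ge0// /p; ring.
Qed.

(** The vector (grad p - F) / p is [2 * A1], [2 * A2] and involves only u and dbar u: its half has
    square norm 4 Q |u|^4 / p^2 <= 4 Q. The rest is 2 A s <= A^2 + s^2 in each component. *)
Lemma gradient_term_upper (R : realFieldType) (a ax ay b bx bY g gx gy Q s t : R) :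
  0 < g -> 0 <= Q ->
  (ax - bY) ^+ 2 + (bx + ay) ^+ 2 = 4 * Q * (a ^+ 2 + b ^+ 2) ->
  let p := a ^+ 2 + b ^+ 2 + g in
  let px := 2 * a * ax + 2 * b * bx + gx in
  let py := 2 * a * ay + 2 * b * bY + gy in
  let F1 := 2 * (a * bY - b * ay) + gx in
  let F2 := - 2 * (a * bx - b * ax) + gy in
  is_true ((px / p - F1 / p) * s + (py / p - F2 / p) * t <=
           s ^+ 2 + t ^+ 2 + 4 * Q).
Proof.
move=> g0 Q0 S p px py F1 F2.
have u0 : 0 <= a ^+ 2 + b ^+ 2 by rewrite addr_ge0 ?sqr_ge0.
have p0 : 0 < p by rewrite ltr_wpDl.
set A1 := (a * (ax - bY) + b * (bx + ay)) / p.
set A2 := (a * (bx + ay) - b * (ax - bY)) / p.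
have -> : px / p - F1 / p = 2 * A1 by rewrite /px /F1 /A1; field; rewrite gt_eqF.
have -> : py / p - F2 / p = 2 * A2 by rewrite /py /F2 /A2; field; rewrite gt_eqF.
have A : A1 ^+ 2 + A2 ^+ 2 <= 4 * Q.
  have -> : A1 ^+ 2 + A2 ^+ 2 = (a ^+ 2 + b ^+ 2) *
    ((ax - bY) ^+ 2 + (bx + ay) ^+ 2) / p ^+ 2.
    by rewrite /A1 /A2; field; rewrite gt_eqF.
  rewrite S ler_pdivrMr ?exprn_gt0//.
  rewrite (_ : _ * _ = 4 * Q * (a ^+ 2 + b ^+ 2) ^+ 2); last by ring.
  by rewrite ler_wpM2l ?mulr_ge0 // ler_sqr ?nnegrE ?(ltW p0)// /p; lra.
have := sqr_ge0 (A1 - s); have := sqr_ge0 (A2 - t); nra.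
Qed.

(* The profile vanishes to second order at the ends of [x0 - rho, x0 + rho]; for large [m]
   the product of two profiles is subharmonic outside a small square. *)
Definition bump_profile (R : realType) (rho x0 : R) (m : nat) (x : R) : R :=
  (rho ^+ 2 - (x - x0) ^+ 2) ^+ m.+2.
Definition bump_profile1 (R : realType) (rho x0 : R) (m : nat) (x : R) : R :=
  - 2 * m.+2%:R * (x - x0) * (rho ^+ 2 - (x - x0) ^+ 2) ^+ m.+1.
Definition bump_profile2 (R : realType) (rho x0 : R) (m : nat) (x : R) : R :=
  2 * m.+2%:R * (rho ^+ 2 - (x - x0) ^+ 2) ^+ m *
  ((2 * m%:R + 3) * (x - x0) ^+ 2 - rho ^+ 2).

Lemma is_der_bump_profile (R : realType) (rho x0 : R) (m : nat) (x : R) :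
  is_derive x 1 (bump_profile rho x0 m) (bump_profile1 rho x0 m x).
Proof.
rewrite /bump_profile /bump_profile1.
refine (is_der_eq (is_derX m.+2 (is_derB (is_der_cst _ _)
  (is_derX 2 (is_derB (is_der_id _) (is_der_cst _ _))))) _).
by rewrite /=; ring.
Qed.

Lemma is_der_bump_profile1 (R : realType) (rho x0 : R) (m : nat) (x : R) :
  is_derive x 1 (bump_profile1 rho x0 m) (bump_profile2 rho x0 m x).
Proof.
rewrite /bump_profile1 /bump_profile2.
refine (is_der_eq (is_derM (is_derM (is_der_cst _ _) (is_derB (is_der_id _) (is_der_cst _ _)))
  (is_derX m.+1 (is_derB (is_der_cst _ _)
  (is_derX 2 (is_derB (is_der_id _) (is_der_cst _ _)))))) _).
by rewrite /= -[m.+2%:R]natr1 -[m.+1%:R]natr1 exprS; ring.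
Qed.

Lemma bump_profile_ends (R : realType) (rho x0 : R) (m : nat) :
  [/\ bump_profile rho x0 m (x0 - rho) = 0, bump_profile rho x0 m (x0 + rho) = 0,
      bump_profile1 rho x0 m (x0 - rho) = 0 & bump_profile1 rho x0 m (x0 + rho) = 0].
Proof.
have E1 : rho ^+ 2 - (x0 - rho - x0) ^+ 2 = 0 by ring.
have E2 : rho ^+ 2 - (x0 + rho - x0) ^+ 2 = 0 by ring.
by rewrite /bump_profile /bump_profile1 E1 E2 !expr0n /= !mulr0.
Qed.

Lemma sqr_diff_le (R : realFieldType) (rho x0 x : R) : x0 - rho <= x <= x0 + rho ->
  0 <= rho ^+ 2 - (x - x0) ^+ 2.
Proof. by move=> /andP[? ?]; nra. Qed.

Lemma bump_profile_ge0 (R : realType) (rho x0 : R) (m : nat) (x : R) :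
  x0 - rho <= x <= x0 + rho -> 0 <= bump_profile rho x0 m x.
Proof. by move=> /sqr_diff_le h; exact: exprn_ge0. Qed.

(** For the larger coordinate, K Y - r >= r, and its weight (r - X)^2 is at least (r - Y)^2. It
    therefore absorbs - r (r - Y)^2, the only negative contribution. *)
Lemma bump_laplacian_half (R : realFieldType) (K s r X Y : R) :
  0 <= K -> 2 * r <= K * s -> s <= Y -> 0 <= X -> X <= Y -> Y <= r ->
  0 <= (K * X - r) * (r - Y) ^+ 2 + (K * Y - r) * (r - X) ^+ 2.
Proof.
move=> K0 Ks sY X0 XY Yr.
have KY : 2 * r <= K * Y by rewrite (le_trans Ks)// ler_wpM2l.
have V : (r - Y) ^+ 2 <= (r - X) ^+ 2 by rewrite ler_sqr ?nnegrE; lra.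
have V0 := sqr_ge0 (r - Y).
have h1 : (K * Y - r) * (r - Y) ^+ 2 <= (K * Y - r) * (r - X) ^+ 2.
  by rewrite ler_wpM2l//; lra.
have h2 : 0 <= (K * X + K * Y - 2 * r) * (r - Y) ^+ 2.
  by rewrite mulr_ge0//; have := mulr_ge0 K0 X0; lra.
lra.
Qed.

(** Once the common powers are factored out, what remains is the expression of
    [bump_laplacian_half], with K the coefficient 2 m + 3 of [bump_profile2]; it is symmetric in the
    two coordinates. A large [m] thus confines the failure of subharmonicity to a square of
    half-width [s]. *)
Lemma bump_laplacian_ge0 (R : realType) (rho x0 y0 s : R) (m : nat) (x y : R) :
  x0 - rho <= x <= x0 + rho -> y0 - rho <= y <= y0 + rho -> 0 <= s ->
  2 * rho ^+ 2 <= (2 * m%:R + 3) * s ^+ 2 -> (s <= `|x - x0|) || (s <= `|y - y0|) ->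
  0 <= bump_profile2 rho x0 m x * bump_profile rho y0 m y +
       bump_profile rho x0 m x * bump_profile2 rho y0 m y.
Proof.
move=> xr yr s0 Ks sxy; rewrite /bump_profile2 /bump_profile.
have X0 := sqr_ge0 (x - x0); have Y0 := sqr_ge0 (y - y0).
have K0 : 0 <= 2 * m%:R + 3 :> R by rewrite addr_ge0 ?mulr_ge0.
have {xr} := sqr_diff_le xr; have {yr} := sqr_diff_le yr.
have : (s ^+ 2 <= (x - x0) ^+ 2) || (s ^+ 2 <= (y - y0) ^+ 2).
  rewrite -(real_normK (num_real (x - x0))) -(real_normK (num_real (y - y0))).
  by rewrite !ler_sqr ?nnegrE.
set X := (x - x0) ^+ 2 in X0 *; set Y := (y - y0) ^+ 2 in Y0 *.
move: (rho ^+ 2) Ks => r Ks sXY rY rX; set K := 2 * m%:R + 3 in K0 Ks *.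
rewrite (_ : _ + _ = 2 * m.+2%:R * ((r - X) ^+ m * (r - Y) ^+ m) *
  ((K * X - r) * (r - Y) ^+ 2 + (K * Y - r) * (r - X) ^+ 2)); last first.
  by rewrite ![_ ^+ m.+2]exprS ![_ ^+ m.+1]exprS; ring.
rewrite mulr_ge0 ?mulr_ge0 ?exprn_ge0//.
have [XY|/ltW YX] := leP X Y.
  by apply: (@bump_laplacian_half _ K (s ^+ 2)) => //; [case/orP: sXY; lra|lra].
by rewrite addrC; apply: (@bump_laplacian_half _ K (s ^+ 2)) => //; [case/orP: sXY; lra|lra].
Qed.

(** * Continuity rules, the weight, and the vector field to be integrated *)

Section continuity_rules.
Context {R : realType} {T : topologicalType}.
Implicit Types (f g : T -> R) (p : T).

Lemma cont_cst (c : R) p : {for p, continuous (fun _ : T => c)}.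
Proof. exact: cvg_cst. Qed.

Lemma contD f g p : {for p, continuous f} -> {for p, continuous g} ->
  {for p, continuous (fun q => f q + g q)}.
Proof. by move=> fc gc; exact: cvgD. Qed.

Lemma contB f g p : {for p, continuous f} -> {for p, continuous g} ->
  {for p, continuous (fun q => f q - g q)}.
Proof. by move=> fc gc; exact: cvgB. Qed.

Lemma contM f g p : {for p, continuous f} -> {for p, continuous g} ->
  {for p, continuous (fun q => f q * g q)}.
Proof. by move=> fc gc; exact: cvgM. Qed.

Lemma contX f n p : {for p, continuous f} -> {for p, continuous (fun q => f q ^+ n)}.
Proof.
move=> fc; elim: n => [|n IH]; first exact: cont_cst.
under [X in {for p, continuous X}]eq_fun do rewrite exprS.
exact: contM.
Qed.

Lemma contV f p : f p != 0 -> {for p, continuous f} ->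
  {for p, continuous (fun q => (f q)^-1)}.
Proof. by move=> fp fc; exact: cvgV. Qed.

Lemma cont_comp (h : R -> R) f p : {for f p, continuous h} -> {for p, continuous f} ->
  {for p, continuous (fun q => h (f q))}.
Proof. by move=> hc fc; exact: (@continuous_comp _ _ _ f h). Qed.

Lemma cont_ln f p : 0 < f p -> {for p, continuous f} ->
  {for p, continuous (fun q => ln (f q))}.
Proof. by move=> fp; apply: cont_comp; exact: continuous_ln. Qed.

End continuity_rules.

Lemma cont_fst (R : realType) (p : R * R) : {for p, continuous (fun q : R * R => q.1)}.
Proof. exact: cvg_fst. Qed.

Lemma cont_snd (R : realType) (p : R * R) : {for p, continuous (fun q : R * R => q.2)}.
Proof. exact: cvg_snd. Qed.

(** A difference is the sum with an opposite, so its clause has to precede the clause for sums.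
    Atomic functions are closed by a continuity hypothesis of the context, applied to a further
    hypothesis if necessary. *)
Ltac cont_step :=
  lazymatch goal with
  | |- prop_for _ (inPhantom (forall x, @continuous_at _ _ x ?F)) =>
    lazymatch F with
    | (fun q => Algebra.add (@?f q) (Algebra.opp (@?g q))) => apply: (@contB _ _ f g)
    | (fun q => Algebra.add (@?f q) (@?g q)) => apply: (@contD _ _ f g)
    | (fun q => GRing.mul (@?f q) (@?g q)) => apply: (@contM _ _ f g)
    | (fun q => GRing.exp (@?f q) ?n) => apply: (@contX _ _ f n)
    | (fun q => fst q) => exact: cont_fst
    | (fun q => snd q) => exact: cont_snd
    | (fun q => GRing.inv (@?f q)) => apply: (@contV _ _ f)
    | (fun q => ?f q) =>
      match goal with
      | H : context [@continuous_at _ _ _ f] |- _ => exact: H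
      | H : context [@continuous_at _ _ _ f], K : _ |- _ => exact: (H _ K)
      end
    | _ => exact: cont_cst
    end
  end.
Ltac cont := repeat cont_step.

Section weight.
Context {R : realType}.
Variables (x1 y1 tau : R) (N : nat).
Implicit Types (p : R * R) (x y : R).

(* [wg = exp h] for [h = M ln (|z - z1|^2 + tau^2)], where [M = N + 2]: as [tau] tends
   to 0, the Laplacian of [h] concentrates to a mass proportional to [M] at [z1]. *)
Definition wq p := (p.1 - x1) ^+ 2 + (p.2 - y1) ^+ 2 + tau ^+ 2.
Definition wg p := wq p ^+ N.+2.
Definition wgx p := N.+2%:R * wq p ^+ N.+1 * (2 * (p.1 - x1)).
Definition wgy p := N.+2%:R * wq p ^+ N.+1 * (2 * (p.2 - y1)).
Definition wgxx p := N.+2%:R * (N.+1%:R * wq p ^+ N * (2 * (p.1 - x1)) ^+ 2 + 2 * wq p ^+ N.+1).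
Definition wgyy p := N.+2%:R * (N.+1%:R * wq p ^+ N * (2 * (p.2 - y1)) ^+ 2 + 2 * wq p ^+ N.+1).

Lemma wq_gt0 p : 0 < tau -> 0 < wq p.
Proof. by move=> t0; rewrite ltr_wpDl ?exprn_gt0// addr_ge0 ?sqr_ge0. Qed.

Lemma cont_wq p : {for p, continuous wq}.
Proof. by rewrite /wq; cont. Qed.

Lemma is_der_wq_x x y : is_derive x 1 (fun t => wq (t, y)) (2 * (x - x1)).
Proof.
rewrite /wq /=; refine (is_der_eq (is_derD (is_derD
  (is_derX 2 (is_derB (is_der_id _) (is_der_cst _ _))) (is_der_cst _ _)) (is_der_cst _ _)) _).
by rewrite /=; ring.
Qed.

Lemma is_der_wq_y x y : is_derive y 1 (fun t => wq (x, t)) (2 * (y - y1)).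
Proof.
rewrite /wq /=; refine (is_der_eq (is_derD (is_derD (is_der_cst _ _)
  (is_derX 2 (is_derB (is_der_id _) (is_der_cst _ _)))) (is_der_cst _ _)) _).
by rewrite /=; ring.
Qed.

Lemma is_der_wg_x x y : is_derive x 1 (fun t => wg (t, y)) (wgx (x, y)).
Proof. exact: is_derX (is_der_wq_x x y). Qed.

Lemma is_der_wg_y x y : is_derive y 1 (fun t => wg (x, t)) (wgy (x, y)).
Proof. exact: is_derX (is_der_wq_y x y). Qed.

Lemma is_der_wgx_x x y : is_derive x 1 (fun t => wgx (t, y)) (wgxx (x, y)).
Proof.
rewrite /wgx /=; refine (is_der_eq (is_derM (is_derM (is_der_cst _ _)
  (is_derX _ (is_der_wq_x x y)))
  (is_derM (is_der_cst _ _) (is_derB (is_der_id _) (is_der_cst _ _)))) _).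
by rewrite /wgxx /=; ring.
Qed.

Lemma is_der_wgy_y x y : is_derive y 1 (fun t => wgy (x, t)) (wgyy (x, y)).
Proof.
rewrite /wgy /=; refine (is_der_eq (is_derM (is_derM (is_der_cst _ _)
  (is_derX _ (is_der_wq_y x y)))
  (is_derM (is_der_cst _ _) (is_derB (is_der_id _) (is_der_cst _ _)))) _).
by rewrite /wgyy /=; ring.
Qed.

(** The left side is g^2 Laplacian (ln g), and Laplacian (ln wq) = 4 tau^2 / wq^2. The exponent
    [N.+2] leaves a natural power of [wq] after this division. *)
Lemma wg_curvature p : wg p * (wgxx p + wgyy p) - wgx p ^+ 2 - wgy p ^+ 2 =
  4 * N.+2%:R * tau ^+ 2 * (wq p ^+ N.+1) ^+ 2.
Proof.
rewrite /wg /wgxx /wgyy /wgx /wgy ![_ ^+ N.+2]exprS ![_ ^+ N.+1]exprS.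
rewrite -[N.+2%:R]natr1 -[N.+1%:R]natr1.
rewrite (_ : tau ^+ 2 = wq p - (p.1 - x1) ^+ 2 - (p.2 - y1) ^+ 2); last by rewrite /wq; ring.
by ring.
Qed.

Lemma cont_wg p : {for p, continuous wg}.
Proof. by rewrite /wg; apply: contX; exact: cont_wq. Qed.

Lemma cont_wgx p : {for p, continuous wgx}.
Proof. by have := cont_wq (p := p); rewrite /wgx => h; cont. Qed.
Lemma cont_wgy p : {for p, continuous wgy}.
Proof. by have := cont_wq (p := p); rewrite /wgy => h; cont. Qed.
Lemma cont_wgxx p : {for p, continuous wgxx}.
Proof. by have := cont_wq (p := p); rewrite /wgxx => h; cont. Qed.
Lemma cont_wgyy p : {for p, continuous wgyy}.
Proof. by have := cont_wq (p := p); rewrite /wgyy => h; cont. Qed.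

End weight.

(** One function [fxy] serves as both mixed derivatives, so that their cancellation in the
    divergence is a polynomial identity. *)
Record C2_on (R : realType) (W : set (R * R)) (f fx fy fxy : R * R -> R) : Prop := {
  C2c : forall p, W p -> {for p, continuous f};
  C2xc : forall p, W p -> {for p, continuous fx};
  C2yc : forall p, W p -> {for p, continuous fy};
  C2xyc : forall p, W p -> {for p, continuous fxy};
  C2_x : forall x y, W (x, y) -> is_derive x 1 (fun t => f (t, y)) (fx (x, y));
  C2_y : forall x y, W (x, y) -> is_derive y 1 (fun t => f (x, t)) (fy (x, y));
  C2_xy : forall x y, W (x, y) -> is_derive y 1 (fun t => fx (x, t)) (fxy (x, y));
  C2_yx : forall x y, W (x, y) -> is_derive x 1 (fun t => fy (t, y)) (fxy (x, y)) }.

(* With [psi] the bump and [F] equal to [grad P] minus its part containing dbar u,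
   [lp_div] is the divergence of [(ln P) grad psi - psi F / P]. The second derivatives
   of u enter [div F] only through mixed ones, which cancel. *)
Section log_potential.
Context {R : realType}.
Variables (W : set (R * R)) (a ax ay axy b bx bY bxy : R * R -> R).
Hypothesis oW : open W.
Hypotheses (Ca : C2_on W a ax ay axy) (Cb : C2_on W b bx bY bxy).
Let ac := C2c Ca. Let axc := C2xc Ca. Let ayc := C2yc Ca. Let axyc := C2xyc Ca.
Let bc := C2c Cb. Let bxc := C2xc Cb. Let byc := C2yc Cb. Let bxyc := C2xyc Cb.
Let a_x := C2_x Ca. Let a_y := C2_y Ca. Let a_xy := C2_xy Ca. Let a_yx := C2_yx Ca.
Let b_x := C2_x Cb. Let b_y := C2_y Cb. Let b_xy := C2_xy Cb. Let b_yx := C2_yx Cb.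
Variables (x0 y0 rho : R) (m : nat) (x1 y1 tau : R) (N : nat).
Hypotheses (rho0 : 0 < rho) (tau0 : 0 < tau).

Let B := box (x0 - rho) (x0 + rho) (y0 - rho) (y0 + rho).
Hypothesis BW : B `<=` W.

Let g := wg x1 y1 tau N.
Let gx := wgx x1 y1 tau N.
Let gy := wgy x1 y1 tau N.
Let gxx := wgxx x1 y1 tau N.
Let gyy := wgyy x1 y1 tau N.

Definition lp_den p := a p ^+ 2 + b p ^+ 2 + g p.
Let P := lp_den.
Let Px p := 2 * a p * ax p + 2 * b p * bx p + gx p.
Let Py p := 2 * a p * ay p + 2 * b p * bY p + gy p.
Let F1 p := 2 * (a p * bY p - b p * ay p) + gx p.
Let F2 p := - 2 * (a p * bx p - b p * ax p) + gy p.
Let F1x p := 2 * (ax p * bY p + a p * bxy p - bx p * ay p - b p * axy p) + gxx p.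
Let F2y p := - 2 * (ay p * bx p + a p * bxy p - bY p * ax p - b p * axy p) + gyy p.
Definition bump (p : R * R) := bump_profile rho x0 m p.1 * bump_profile rho y0 m p.2.
Definition bump_x (p : R * R) := bump_profile1 rho x0 m p.1 * bump_profile rho y0 m p.2.
Definition bump_y (p : R * R) := bump_profile rho x0 m p.1 * bump_profile1 rho y0 m p.2.
Definition bump_xx (p : R * R) := bump_profile2 rho x0 m p.1 * bump_profile rho y0 m p.2.
Definition bump_yy (p : R * R) := bump_profile rho x0 m p.1 * bump_profile2 rho y0 m p.2.

Let D1 p := Px p / P p * bump_x p + ln (P p) * bump_xx p -
  (bump_x p * (F1 p / P p) + bump p * ((F1x p * P p - F1 p * Px p) / P p ^+ 2)).
Let D2 p := Py p / P p * bump_y p + ln (P p) * bump_yy p -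
  (bump_y p * (F2 p / P p) + bump p * ((F2y p * P p - F2 p * Py p) / P p ^+ 2)).

Definition lp_div p := D1 p + D2 p.

Lemma lp_den_gt0 p : 0 < P p.
Proof. by rewrite /P /lp_den ltr_wpDl ?addr_ge0 ?sqr_ge0// exprn_gt0// wq_gt0. Qed.

Let gc p : {for p, continuous g}. Proof. exact: cont_wg. Qed.
Let gxc p : {for p, continuous gx}. Proof. exact: cont_wgx. Qed.
Let gyc p : {for p, continuous gy}. Proof. exact: cont_wgy. Qed.
Let gxxc p : {for p, continuous gxx}. Proof. exact: cont_wgxx. Qed.
Let gyyc p : {for p, continuous gyy}. Proof. exact: cont_wgyy. Qed.

Let Pc p : W p -> {for p, continuous P}. Proof. by move=> Wp; rewrite /P /lp_den; cont. Qed.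
Let Pxc p : W p -> {for p, continuous Px}. Proof. by move=> Wp; rewrite /Px; cont. Qed.
Let Pyc p : W p -> {for p, continuous Py}. Proof. by move=> Wp; rewrite /Py; cont. Qed.
Let F1c p : W p -> {for p, continuous F1}. Proof. by move=> Wp; rewrite /F1; cont. Qed.
Let F2c p : W p -> {for p, continuous F2}. Proof. by move=> Wp; rewrite /F2; cont. Qed.
Let F1xc p : W p -> {for p, continuous F1x}. Proof. by move=> Wp; rewrite /F1x; cont. Qed.
Let F2yc p : W p -> {for p, continuous F2y}. Proof. by move=> Wp; rewrite /F2y; cont. Qed.

Lemma cont_bump p : {for p, continuous bump}.
Proof. by rewrite /bump /bump_profile; cont. Qed.
Lemma cont_bump_x p : {for p, continuous bump_x}.
Proof. by rewrite /bump_x /bump_profile /bump_profile1; cont. Qed.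
Lemma cont_bump_y p : {for p, continuous bump_y}.
Proof. by rewrite /bump_y /bump_profile /bump_profile1; cont. Qed.
Lemma cont_bump_xx p : {for p, continuous bump_xx}.
Proof. by rewrite /bump_xx /bump_profile /bump_profile2; cont. Qed.
Lemma cont_bump_yy p : {for p, continuous bump_yy}.
Proof. by rewrite /bump_yy /bump_profile /bump_profile2; cont. Qed.

Let D1c p : W p -> {for p, continuous D1}.
Proof.
move=> Wp; have P0 : P p != 0 by rewrite gt_eqF// lp_den_gt0.
have P20 : P p ^+ 2 != 0 by rewrite expf_neq0.
have c1 := @cont_bump p; have c2 := @cont_bump_x p; have c3 := @cont_bump_xx p.
have c4 := cont_ln (lp_den_gt0 p) (Pc Wp).
by rewrite /D1; cont => //; exact: c4.
Qed.

Let D2c p : W p -> {for p, continuous D2}.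
Proof.
move=> Wp; have P0 : P p != 0 by rewrite gt_eqF// lp_den_gt0.
have P20 : P p ^+ 2 != 0 by rewrite expf_neq0.
have c1 := @cont_bump p; have c2 := @cont_bump_y p; have c3 := @cont_bump_yy p.
have c4 := cont_ln (lp_den_gt0 p) (Pc Wp).
by rewrite /D2; cont => //; exact: c4.
Qed.

Let P_x x y : W (x, y) -> is_derive x 1 (fun t => P (t, y)) (Px (x, y)).
Proof.
move=> Wp; refine (is_der_eq (is_derD (is_derD (is_derX 2 (a_x Wp)) (is_derX 2 (b_x Wp)))
  (is_der_wg_x _ _ _ _ _ _)) _).
by rewrite /Px /gx /=; ring.
Qed.

Let P_y x y : W (x, y) -> is_derive y 1 (fun t => P (x, t)) (Py (x, y)).
Proof.
move=> Wp; refine (is_der_eq (is_derD (is_derD (is_derX 2 (a_y Wp)) (is_derX 2 (b_y Wp)))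
  (is_der_wg_y _ _ _ _ _ _)) _).
by rewrite /Py /gy /=; ring.
Qed.

Let F1_x x y : W (x, y) -> is_derive x 1 (fun t => F1 (t, y)) (F1x (x, y)).
Proof.
move=> Wp; refine (is_der_eq (is_derD (is_derM (is_der_cst _ _) (is_derB
   (is_derM (a_x Wp) (b_yx Wp)) (is_derM (b_x Wp) (a_yx Wp))))
  (is_der_wgx_x _ _ _ _ _ _)) _).
by rewrite /F1x /gxx /=; ring.
Qed.

Let F2_y x y : W (x, y) -> is_derive y 1 (fun t => F2 (x, t)) (F2y (x, y)).
Proof.
move=> Wp; refine (is_der_eq (is_derD (is_derM (is_der_cst _ _) (is_derB
   (is_derM (a_y Wp) (b_xy Wp)) (is_derM (b_y Wp) (a_xy Wp))))
  (is_der_wgy_y _ _ _ _ _ _)) _).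
by rewrite /F2y /gyy /=; ring.
Qed.

Let X1 p := ln (P p) * bump_x p - bump p * (F1 p / P p).
Let X2 p := ln (P p) * bump_y p - bump p * (F2 p / P p).

Let X1_x x y : W (x, y) -> is_derive x 1 (fun t => X1 (t, y)) (D1 (x, y)).
Proof.
move=> Wp; have P0 := lp_den_gt0 (x, y).
have P0' : P (x, y) != 0 by rewrite gt_eqF.
refine (is_der_eq (is_derB
   (is_derM (@is_der_ln R (fun t => P (t, y)) x _ P0 (P_x Wp))
     (is_derM (is_der_bump_profile1 rho x0 m x) (is_der_cst (bump_profile rho y0 m y) x)))
   (is_derM (is_derM (is_der_bump_profile rho x0 m x) (is_der_cst (bump_profile rho y0 m y) x))
     (@is_der_div R (fun t => F1 (t, y)) (fun t => P (t, y)) x _ _ P0' (F1_x Wp) (P_x Wp)))) _).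
by rewrite /D1 /bump_x /bump_xx /bump /= !mulr0 !addr0.
Qed.

Let X2_y x y : W (x, y) -> is_derive y 1 (fun t => X2 (x, t)) (D2 (x, y)).
Proof.
move=> Wp; have P0 := lp_den_gt0 (x, y).
have P0' : P (x, y) != 0 by rewrite gt_eqF.
refine (is_der_eq (is_derB
   (is_derM (@is_der_ln R (fun t => P (x, t)) y _ P0 (P_y Wp))
     (is_derM (is_der_cst (bump_profile rho x0 m x) y) (is_der_bump_profile1 rho y0 m y)))
   (is_derM (is_derM (is_der_cst (bump_profile rho x0 m x) y) (is_der_bump_profile rho y0 m y))
     (@is_der_div R (fun t => F2 (x, t)) (fun t => P (x, t)) y _ _ P0' (F2_y Wp) (P_y Wp)))) _).
by rewrite /D2 /bump_y /bump_yy /bump /= !mul0r !add0r.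
Qed.

Lemma cont_lp_div p : W p -> {for p, continuous lp_div}.
Proof. by move=> Wp; apply: contD; [exact: D1c|exact: D2c]. Qed.

Lemma integrable_lp_div : (lam2 R).-integrable B (EFin \o lp_div).
Proof. exact: continuous_box_integrable cont_lp_div. Qed.

(** The profile and its first derivative vanish at both ends, so the field, which contains the bump
    and its gradient as factors, has no boundary contribution. *)
Lemma integral_lp_div : (\int[lam2 R]_(p in B) (lp_div p)%:E = 0)%E.
Proof.
have mB : measurable B by exact: measurable_box.
under eq_integral do rewrite EFinD.
rewrite integralD//; last 2 first.
- exact: continuous_box_integrable D1c.
- exact: continuous_box_integrable D2c.
have E1 : (\int[lam2 R]_(p in B) (D1 p)%:E = 0)%E.
  have xr : x0 - rho < x0 + rho by rewrite ltrBlDr -addrA ltrDl addr_gt0.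
  apply: (int_box_dx xr oW BW D1c X1_x).
  move=> y _; have [e1 e2 e3 e4] := bump_profile_ends rho x0 m.
  by rewrite /X1 /bump_x /bump /= e1 e2 e3 e4 !(mul0r, mulr0, subrr).
have E2 : (\int[lam2 R]_(p in B) (D2 p)%:E = 0)%E.
  have yr : y0 - rho < y0 + rho by rewrite ltrBlDr -addrA ltrDl addr_gt0.
  apply: (int_box_dy yr oW BW D2c X2_y).
  move=> x _; have [e1 e2 e3 e4] := bump_profile_ends rho y0 m.
  by rewrite /X2 /bump_y /bump /= e1 e2 e3 e4 !(mul0r, mulr0, subrr).
by rewrite E1 E2 adde0.
Qed.

(** Expanded, [lp_div] is ln P times the Laplacian of the bump, plus the scalar product of (grad P -
    F) / P with its gradient, minus the bump times div (F / P). The last two are estimated by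
    [gradient_term_upper] and [divergence_lower]. *)
Lemma lp_div_upper p Q : B p -> 0 <= Q ->
  (ax p - bY p) ^+ 2 + (bx p + ay p) ^+ 2 = 4 * Q * (a p ^+ 2 + b p ^+ 2) ->
  lp_div p <= ln (P p) * (bump_xx p + bump_yy p) + bump_x p ^+ 2 + bump_y p ^+ 2 +
     (4 + bump p) * Q
     - bump p * (4 * N.+2%:R * tau ^+ 2 * wq x1 y1 tau p ^+ N / P p).
Proof.
move=> Bp Q0 S.
have g0 : 0 < g p by rewrite exprn_gt0// wq_gt0.
have q0 : 0 < wq x1 y1 tau p by exact: wq_gt0.
have P0 := lp_den_gt0 p.
have /boxP[B1 B2] := Bp.
have psi0 : 0 <= bump p by rewrite mulr_ge0// bump_profile_ge0.
have L := @divergence_lower R (a p) (ax p) (ay p) (axy p) (b p) (bx p) (bY p) (bxy p)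
  (g p) (gx p) (gy p) (gxx p) (gyy p) Q g0 Q0 S.
have U := @gradient_term_upper R (a p) (ax p) (ay p) (b p) (bx p) (bY p)
  (g p) (gx p) (gy p) Q (bump_x p) (bump_y p) g0 Q0 S.
rewrite /= -/(P p) -/(Px p) -/(Py p) -/(F1 p) -/(F2 p) -/(F1x p) -/(F2y p) in L U.
have E : (g p * (gxx p + gyy p) - gx p ^+ 2 - gy p ^+ 2) / (g p * P p) =
   4 * N.+2%:R * tau ^+ 2 * wq x1 y1 tau p ^+ N / P p.
  rewrite wg_curvature /g /wg ![wq _ _ _ _ ^+ N.+2]exprS ![wq _ _ _ _ ^+ N.+1]exprS.
  by field; rewrite !gt_eqF ?exprn_gt0.
rewrite E in L.
have {L} := ler_wpM2l psi0 L; move: U.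
rewrite -/(lp_den p) -/(P p) /lp_div /D1 /D2.
move: (F1 p / P p) (F2 p / P p) (Px p / P p) (Py p / P p) (ln _) (bump p) (bump_x p)
  (bump_y p) (bump_xx p) (bump_yy p) ((_ - _) / _) ((_ - _) / _) (_ / P p).
by move=> {E}*; lra.
Qed.

End log_potential.

(** On a square of side tau, a density of M / (2 tau^2) has mass M / 2 for every tau. The hypothesis
    on [P] comes from |u|^2 <= g. *)
Lemma measure_bound_from_kink (R : realType) (tau M q P psi psi0 : R) (N : nat) :
  0 < tau -> 0 <= M -> tau ^+ 2 <= q -> q <= 2 * tau ^+ 2 -> 0 < P -> P <= 2 * q ^+ N.+2 ->
  0 <= psi0 -> psi0 <= psi ->
  psi0 * (M / (2 * tau ^+ 2)) <= psi * (4 * M * tau ^+ 2 * q ^+ N / P).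
Proof.
move=> t0 M0 tq qt P0 Pq psi00 psiq.
have t20 : 0 < tau ^+ 2 by rewrite exprn_gt0.
have q0 : 0 < q by apply: lt_le_trans tq.
have qN : 0 < q ^+ N by rewrite exprn_gt0.
apply: ler_pM => //; first by rewrite divr_ge0// mulr_ge0// ltW.
rewrite ler_pdivlMr// mulrAC ler_pdivrMr ?mulr_gt0//.
apply: (@le_trans _ _ (M * (2 * q ^+ N.+2))); first by rewrite ler_wpM2l.
rewrite (_ : _ * (2 * tau ^+ 2) = M * (8 * (tau ^+ 2) ^+ 2 * q ^+ N)); last by ring.
rewrite ler_wpM2l// (_ : 2 * q ^+ N.+2 = 2 * q ^+ 2 * q ^+ N); last by rewrite !exprS; ring.
rewrite ler_wpM2r//; first exact: ltW.
have : q ^+ 2 <= (2 * tau ^+ 2) ^+ 2 by rewrite ler_sqr ?nnegrE// ltW// mulr_gt0.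
by rewrite exprMn; lra.
Qed.

(** * A bound on the order of vanishing, and unique continuation *)

Section vanishing_order_bound.
Context {R : realType}.
Variables (W : set (R * R)) (a ax ay axy b bx bY bxy : R * R -> R).
Hypothesis oW : open W.
Hypotheses (Ca : C2_on W a ax ay axy) (Cb : C2_on W b bx bY bxy).
Variables (x0 y0 rho s c0 C0 : R) (m : nat) (Q : R * R -> R).
Hypotheses (rho0 : 0 < rho) (s0 : 0 <= s) (ms : 2 * rho ^+ 2 <= (2 * m%:R + 3) * s ^+ 2).
Let B := box (x0 - rho) (x0 + rho) (y0 - rho) (y0 + rho).
Hypotheses (BW : B `<=` W) (c00 : 0 < c0)
  (u_low : forall p, B p -> `|p.1 - x0| < s -> `|p.2 - y0| < s -> c0 <= a p ^+ 2 + b p ^+ 2)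
  (u_up : forall p, B p -> a p ^+ 2 + b p ^+ 2 <= C0)
  (Q0 : forall p, 0 <= Q p) (iQ : (lam2 R).-integrable B (EFin \o Q))
  (dbarQ : (lam2 R).-negligible [set p | B p /\
    (ax p - bY p) ^+ 2 + (bx p + ay p) ^+ 2 != 4 * Q p * (a p ^+ 2 + b p ^+ 2)]).

Let lap p := bump_xx x0 y0 rho m p + bump_yy x0 y0 rho m p.
Let grad p := bump_x x0 y0 rho m p ^+ 2 + bump_y x0 y0 rho m p ^+ 2.

Let constants : exists K1 K2 K3 : R, [/\ 0 <= K1, 0 <= K3 &
  forall p, B p -> [/\ `|lap p| <= K1, grad p <= K2 & bump x0 y0 rho m p <= K3]].
Proof.
have [|K1 K10 H1] := @continuous_box_bounded R (x0 - rho) (x0 + rho) (y0 - rho) (y0 + rho) lap.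
  move=> p _; have h1 := @cont_bump_xx R x0 y0 rho m p; have h2 := @cont_bump_yy R x0 y0 rho m p.
  by rewrite /lap; cont.
have [|K2 K20 H2] := @continuous_box_bounded R (x0 - rho) (x0 + rho) (y0 - rho) (y0 + rho) grad.
  move=> p _; have h1 := @cont_bump_x R x0 y0 rho m p; have h2 := @cont_bump_y R x0 y0 rho m p.
  by rewrite /grad; cont.
have [|K3 K30 H3] := @continuous_box_bounded R (x0 - rho) (x0 + rho)
   (y0 - rho) (y0 + rho) (bump x0 y0 rho m).
  by move=> p _; exact: cont_bump.
exists K1, K2, K3; split; [exact: ltW|exact: ltW|].
move=> p Bp; split; first exact: H1.
  exact: le_trans (ler_norm _) (H2 _ Bp).
exact: le_trans (ler_norm _) (H3 _ Bp).
Qed.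

(** From [wq] <= 1 follows g <= 1, hence P <= C0 + 1 uniformly. Near (x0, y0) also P >= c0, which
    bounds |ln P|. Elsewhere the Laplacian of the bump is nonnegative, so the upper bound on ln P is
    enough, however negative ln P may be. *)
Let log_term (K1 x1 y1 tau : R) N p : B p -> 0 < tau -> wq x1 y1 tau p <= 1 -> `|lap p| <= K1 ->
  ln (lp_den a b x1 y1 tau N p) * lap p <= (`|ln c0| + `|ln (C0 + 1)|) * K1.
Proof.
move=> Bp t0 q1 lK.
have q0 := wq_gt0 x1 y1 p t0.
have g0 : 0 < wg x1 y1 tau N p by rewrite exprn_gt0.
have g1 : wg x1 y1 tau N p <= 1 by rewrite exprn_ile1// ltW.
have u0 : 0 <= a p ^+ 2 + b p ^+ 2 by rewrite addr_ge0 ?sqr_ge0.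
have P0 : 0 < lp_den a b x1 y1 tau N p by rewrite /lp_den; lra.
have lnP : ln (lp_den a b x1 y1 tau N p) <= `|ln (C0 + 1)|.
  apply: le_trans (ler_norm _); rewrite ler_ln ?posrE//.
    by rewrite /lp_den lerD// u_up.
  by have := u_up Bp; lra.
have [/andP[h1 h2]|h] := boolP ((`|p.1 - x0| < s) && (`|p.2 - y0| < s)).
  apply: le_trans (ler_norm _) _; rewrite normrM; apply: ler_pM => //.
  have c0P : ln c0 <= ln (lp_den a b x1 y1 tau N p).
    by rewrite ler_ln ?posrE// /lp_den; have := u_low Bp h1 h2; lra.
  rewrite ler_norml; apply/andP; split; last by rewrite (le_trans lnP)// lerDr.
  by have := ler_norm (- ln c0); rewrite normrN; have := normr_ge0 (ln (C0 + 1)); lra.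
have l0 : 0 <= lap p.
  have /boxP[B1 B2] := Bp; apply: (bump_laplacian_ge0 B1 B2 s0 ms).
  by move: h; rewrite negb_and -!leNgt.
apply: (@le_trans _ _ (`|ln (C0 + 1)| * lap p)); first by rewrite ler_wpM2r.
apply: ler_pM => //; first by rewrite lerDr.
exact: le_trans (ler_norm _) lK.
Qed.

(** The point of the statement is that [K] is fixed before the weight. As [lp_div] has integral 0,
    the mass of the curvature term is at most the integral of C1 + C2 Q. *)
Lemma vanishing_order_bound : exists K : R, forall (x1 y1 tau psi0 : R) N,
  0 < tau -> 0 <= psi0 -> (forall p, B p -> wq x1 y1 tau p <= 1) ->
  box (x1 - tau / 2) (x1 + tau / 2) (y1 - tau / 2) (y1 + tau / 2) `<=` B ->
  (forall p, box (x1 - tau / 2) (x1 + tau / 2) (y1 - tau / 2) (y1 + tau / 2) p ->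
     psi0 <= bump x0 y0 rho m p /\ a p ^+ 2 + b p ^+ 2 <= wg x1 y1 tau N p) ->
  psi0 * N.+2%:R / 2 <= K.
Proof.
have [K1 [K2 [K3 [K10 K30 HK]]]] := constants.
pose C1 := (`|ln c0| + `|ln (C0 + 1)|) * K1 + K2.
pose C2 := 4 + K3.
have C20 : 0 <= C2 by rewrite addr_ge0.
have mB : measurable B by exact: measurable_box.
have if2 : (lam2 R).-integrable B (EFin \o (fun p => C1 + C2 * Q p)).
  apply: (@integrableD _ _ _ (lam2 R) B mB (fun=> C1%:E) (fun p => (C2 * Q p)%:E)).
    apply: (@continuous_box_integrable _ _ _ _ _ setT (fun=> C1)) => //; first exact: openT.
    by move=> p _; exact: cont_cst.
  by under [X in _.-integrable _ X]eq_fun do rewrite EFinM; exact: integrableZl.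
exists (fine (\int[lam2 R]_(p in B) (C1 + C2 * Q p)%:E)) => x1 y1 tau psi0 N t0 psi00 q1 SB HS.
set S := box (x1 - tau / 2) _ _ _ in SB HS.
(* The lower bound of [measure_bound_from_kink]; [S] has area tau^2, so [c * \1_S] has integral psi0
   (N + 2) / 2. *)
pose c := psi0 * (N.+2%:R / (2 * tau ^+ 2)).
pose D := lp_div a ax ay axy b bx bY bxy x0 y0 rho m x1 y1 tau N.
have iD : (lam2 R).-integrable B (EFin \o D) := integrable_lp_div oW Ca Cb m x1 y1 N t0 BW.
have intD : (\int[lam2 R]_(p in B) (D p)%:E = 0)%E :=
  integral_lp_div oW Ca Cb m x1 y1 N rho0 t0 BW.
have mS : measurable S by exact: measurable_box.
have c_ge0 : 0 <= c.
  by rewrite mulr_ge0// divr_ge0// mulr_ge0// sqr_ge0.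
have i1S : (lam2 R).-integrable B (EFin \o \1_S).
  apply: measurable_bounded_integrable => //.
  - exact: lam2_box_lty.
  - exists 1; split => // x x1' p _ /=; rewrite indicE.
    by case: (_ \in _); rewrite ?normr1 ?normr0; lra.
have icS : (lam2 R).-integrable B (EFin \o (fun p => c * \1_S p)).
  by under [X in _.-integrable _ X]eq_fun do rewrite /= EFinM; exact: integrableZl.
have intS : (\int[lam2 R]_(p in B) (c * \1_S p)%:E = (psi0 * N.+2%:R / 2)%:E)%E.
  under eq_integral do rewrite EFinM.
  transitivity (c%:E * lam2 R S)%E; first by rewrite integralZl// integral_indic// setIidl.
  rewrite lam2_box; [|lra|lra].
  by rewrite -EFinM; congr EFin; rewrite /c; field; rewrite gt_eqF.
have if1 : (lam2 R).-integrable B (EFin \o (fun p => D p + c * \1_S p)).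
  exact: (@integrableD _ _ _ (lam2 R) B mB (EFin \o D) (EFin \o (fun p => c * \1_S p))).
have intf1 : (\int[lam2 R]_(p in B) (D p + c * \1_S p)%:E = (psi0 * N.+2%:R / 2)%:E)%E.
  under eq_integral do rewrite EFinD.
  by rewrite integralD// intD intS add0e.
rewrite -lee_fin fineK; last exact: integrable_fin_num.
(* The pointwise comparison requires |dbar u|^2 = Q |u|^2, so the null set where this fails is first
   removed from both integrals. *)
rewrite -intf1; have [E [mE E0 HE]] := dbarQ.
rewrite (negligible_integral mE mB if1 E0) (negligible_integral mE mB if2 E0).
have mBE : measurable (B `\` E) by exact: measurableD.
apply: le_integral => //.
- by apply: integrableS if1 => //; exact: subDsetl.
- by apply: integrableS if2 => //; exact: subDsetl.
move=> p; rewrite inE => -[Bp nEp]; rewrite lee_fin.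
have SQ : (ax p - bY p) ^+ 2 + (bx p + ay p) ^+ 2 = 4 * Q p * (a p ^+ 2 + b p ^+ 2).
  by apply/eqP/negPn/negP => h; apply: nEp; apply: HE.
have := lp_div_upper axy bxy m x1 y1 N t0 Bp (Q0 p) SQ.
have [lK gK psiK] := HK p Bp.
have := log_term N Bp t0 (q1 p Bp) lK.
have P0 : 0 < lp_den a b x1 y1 tau N p by exact: lp_den_gt0.
have QK : (4 + bump x0 y0 rho m p) * Q p <= C2 * Q p by rewrite ler_wpM2r// lerD2l.
have T : c * \1_S p <= bump x0 y0 rho m p *
    (4 * N.+2%:R * tau ^+ 2 * wq x1 y1 tau p ^+ N / lp_den a b x1 y1 tau N p).
  rewrite indicE; have [/set_mem Sp|_] := boolP (p \in S); last first.
    rewrite mulr0 mulr_ge0//.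
      by have /boxP[B1 B2] := Bp; rewrite mulr_ge0// bump_profile_ge0.
    have q0 := ltW (wq_gt0 x1 y1 p t0).
    by rewrite divr_ge0 ?(ltW P0)// mulr_ge0 ?exprn_ge0// mulr_ge0 ?sqr_ge0// mulr_ge0.
  have [psip ug] := HS p Sp; rewrite mulr1.
  have /boxP[/andP[S1 S2] /andP[S3 S4]] := Sp.
  apply: measure_bound_from_kink => //.
  - by rewrite /wq lerDr addr_ge0 ?sqr_ge0.
  - rewrite /wq.
    have := @sqr_diff_le R (tau / 2) x1 p.1; rewrite S1 S2 => /(_ isT) h1.
    have := @sqr_diff_le R (tau / 2) y1 p.2; rewrite S3 S4 => /(_ isT) h2.
    have := sqr_ge0 tau; lra.
  - by move: ug; rewrite /lp_den /wg; lra.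
rewrite -/(lap p) -/D /C1; rewrite /grad in gK; lra.
Qed.

End vanishing_order_bound.

(** This distance does not increase along the path from [p] to [p0] made of two segments parallel to
    the axes, the path used for integration in [O_at_int]. *)
Definition l1 (R : realType) (p0 p : R * R) : R := `|p.1 - p0.1| + `|p.2 - p0.2|.

Definition O_at (R : realType) (p0 : R * R) (k : nat) (f : R * R -> R) :=
  exists C d : R, [/\ 0 <= C, 0 < d & forall p, l1 p0 p < d -> `|f p| <= C * l1 p0 p ^+ k].

Definition flat_at (R : realType) (p0 : R * R) (f : R * R -> R) :=
  forall k, O_at p0 k f.

Lemma l1_ge0 (R : realType) (p0 p : R * R) : 0 <= l1 p0 p.
Proof. by rewrite addr_ge0. Qed.

Lemma exists_small (R : realType) (E : R) : 0 <= E -> exists2 e, 0 < e & E * e ^+ 2 <= 1.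
Proof.
move=> E0; exists (E + 1)^-1; first by rewrite invr_gt0; lra.
by rewrite exprVn ler_pdivrMr ?exprn_gt0; lra || nra.
Qed.

Lemma exists_large_nat (R : realType) (x : R) : exists n : nat, x < n%:R.
Proof.
exists (Num.truncn `|x|).+1; apply: le_lt_trans (ler_norm x) _.
by rewrite truncnS_gt.
Qed.

Lemma exceeds_bound (R : realType) (K c : R) : 0 < c -> exists N : nat, K < c * N.+2%:R / 2.
Proof.
move=> c0; have [N HN] := exists_large_nat (2 * K / c); exists N.
move: HN; rewrite ltr_pdivrMr// -[N.+2%:R]natr1 -[N.+1%:R]natr1; lra.
Qed.

(** Here l1^2 <= 2 wq, so the squares are of order wq^(N+3). That is one power more than g, and this
    power is at most 2 tau^2, which beats the constants for small tau. *)
Lemma sqr_le_wg (R : realType) (p1 p : R * R) (A B C D tau : R) (N : nat) :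
  0 < tau -> 0 <= C -> 0 <= D ->
  `|A| <= C * l1 p1 p ^+ N.+3 -> `|B| <= D * l1 p1 p ^+ N.+3 ->
  box (p1.1 - tau / 2) (p1.1 + tau / 2) (p1.2 - tau / 2) (p1.2 + tau / 2) p ->
  (C ^+ 2 + D ^+ 2) * 2 ^+ N.+3 * 2 * tau ^+ 2 <= 1 ->
  A ^+ 2 + B ^+ 2 <= wg p1.1 p1.2 tau N p.
Proof.
move=> t0 C0 D0 HA HB /boxP[Sx Sy] Ht.
have {Sx} := sqr_diff_le Sx; have {Sy} := sqr_diff_le Sy => h2 h1.
have q0 : 0 < wq p1.1 p1.2 tau p by exact: wq_gt0.
have q2 : wq p1.1 p1.2 tau p <= 2 * tau ^+ 2.
  by rewrite /wq; have := sqr_ge0 tau; lra.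
have l2 : l1 p1 p ^+ 2 <= 2 * wq p1.1 p1.2 tau p.
  rewrite /l1 /wq -(real_normK (num_real (p.1 - p1.1))) -(real_normK (num_real (p.2 - p1.2))).
  by have := sqr_ge0 (`|p.1 - p1.1| - `|p.2 - p1.2|); have := sqr_ge0 tau; lra.
have key (E F : R) : 0 <= F -> `|E| <= F * l1 p1 p ^+ N.+3 ->
    E ^+ 2 <= F ^+ 2 * 2 ^+ N.+3 * 2 * tau ^+ 2 * wg p1.1 p1.2 tau N p.
  move=> F0 HE; rewrite -(real_normK (num_real E)).
  apply: (@le_trans _ _ ((F * l1 p1 p ^+ N.+3) ^+ 2)).
    by rewrite ler_sqr ?nnegrE// mulr_ge0// exprn_ge0// l1_ge0.
  have key' : (l1 p1 p ^+ 2) ^+ N.+3 <= 2 ^+ N.+3 * (2 * tau ^+ 2 * wg p1.1 p1.2 tau N p).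
    apply: (@le_trans _ _ ((2 * wq p1.1 p1.2 tau p) ^+ N.+3)).
      by rewrite lerXn2r ?nnegrE ?sqr_ge0// mulr_ge0// ltW.
    rewrite exprMn; apply: ler_wpM2l; first by rewrite exprn_ge0.
    rewrite [_ ^+ N.+3]exprS; apply: ler_wpM2r => //.
    by rewrite exprn_ge0// ltW.
  rewrite exprMn -exprM mulnC exprM.
  by apply: le_trans (ler_wpM2l (sqr_ge0 F) key') _; rewrite !mulrA.
have g0 : 0 <= wg p1.1 p1.2 tau N p by rewrite exprn_ge0// ltW.
have := key _ _ C0 HA; have := key _ _ D0 HB.
have := ler_wpM2r g0 Ht; lra.
Qed.

(** The constant is 7/16 = 1 - (3/4)^2. *)
Lemma bump_lower (R : realType) (x0 y0 rho : R) (m : nat) (p : R * R) :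
  x0 - (3/4) * rho <= p.1 <= x0 + (3/4) * rho ->
  y0 - (3/4) * rho <= p.2 <= y0 + (3/4) * rho ->
  ((7 / 16) * rho ^+ 2) ^+ m.+2 * ((7 / 16) * rho ^+ 2) ^+ m.+2 <= bump x0 y0 rho m p.
Proof.
move=> /sqr_diff_le e1 /sqr_diff_le e2; have rho20 := sqr_ge0 rho.
have r0 : 0 <= 7 / 16 * rho ^+ 2 by rewrite mulr_ge0.
have f1 : 7 / 16 * rho ^+ 2 <= rho ^+ 2 - (p.1 - x0) ^+ 2 by lra.
have f2 : 7 / 16 * rho ^+ 2 <= rho ^+ 2 - (p.2 - y0) ^+ 2 by lra.
rewrite /bump /bump_profile ler_pM ?exprn_ge0//; apply: lerXn2r => //; rewrite nnegrE //.
  exact: le_trans f1.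
exact: le_trans f2.
Qed.

(** The bump is centred at a hypothetical nonzero [p0], not at the flat point [p1]: its possibly
    negative Laplacian then sits where u is bounded away from 0, while the bump is still positive at
    [p1]. *)
Lemma unique_continuation (R : realType) (W : set (R * R))
    (a ax ay axy b bx bY bxy Q : R * R -> R) (p1 : R * R) (r : R) :
  open W -> C2_on W a ax ay axy -> C2_on W b bx bY bxy ->
  flat_at p1 a -> flat_at p1 b -> 0 < r ->
  let B := box (p1.1 - r) (p1.1 + r) (p1.2 - r) (p1.2 + r) in
  B `<=` W ->
  (forall p, 0 <= Q p) -> (lam2 R).-integrable B (EFin \o Q) ->
  (lam2 R).-negligible [set p | B p /\
    (ax p - bY p) ^+ 2 + (bx p + ay p) ^+ 2 != 4 * Q p * (a p ^+ 2 + b p ^+ 2)] ->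
  exists2 d : R, 0 < d & forall p : R * R, `|p.1 - p1.1| < d -> `|p.2 - p1.2| < d ->
    a p = 0 /\ b p = 0.
Proof.
move=> oW Ca Cb fa fb r0 B BW Q0 iQ nQ.
(* [r1] < 1/2 gives wq <= 1/4 + 1/4 + tau^2 <= 1. With rho = r1 / 2, the box of half-width rho about
   a point within rho / 2 of [p1] stays within r1 of [p1]. *)
have [r1 [r10 r1r r12]] := @below_both R r (1/2) r0 ltac:(lra).
have [rho rhoE] : exists rho, rho = r1 / 2 by exists (r1 / 2).
have rho0 : 0 < rho by lra.
exists (rho / 2) => [|p0 h1 h2]; first by lra.
apply: contrapT => u0.
have {u0} u0 : 0 < a p0 ^+ 2 + b p0 ^+ 2.
  rewrite lt_neqAle addr_ge0 ?sqr_ge0// andbT; apply/negP => /eqP/esym/eqP.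
  by rewrite paddr_eq0 ?sqr_ge0// !expf_eq0/= => /andP[/eqP ? /eqP ?]; apply: u0.
have [x0 x0E] : exists x0, x0 = p0.1 by exists p0.1.
have [y0 y0E] : exists y0, y0 = p0.2 by exists p0.2.
move: h1 h2; rewrite -x0E -y0E; rewrite !ltr_norml => /andP[h1 h1'] /andP[h2 h2'].
pose B0 := box (x0 - rho) (x0 + rho) (y0 - rho) (y0 + rho).
have B0B : B0 `<=` B.
  move=> p /boxP[/andP[q1 q2] /andP[q3 q4]]; apply/boxP; split; apply/andP.
    by move: q1 q2 h1 h1' rhoE rho0 r1r; clear; split; lra.
  by move: q3 q4 h2 h2' rhoE rho0 r1r; clear; split; lra.
have B0W : B0 `<=` W := subset_trans B0B BW.
have Bp0 : B0 p0 by apply/boxP; rewrite -x0E -y0E; split; apply/andP; split; lra.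
have uc p : W p -> {for p, continuous (fun p => a p ^+ 2 + b p ^+ 2)}.
  by move=> Wp; have ac := C2c Ca Wp; have bc := C2c Cb Wp; cont.
have [s0 s00 Hs] := continuous_pairP (uc p0 (B0W _ Bp0))
  (ltac:(by rewrite divr_gt0) : 0 < (a p0 ^+ 2 + b p0 ^+ 2) / 2).
have [C0 C00 HC0] := @continuous_box_bounded R (x0 - rho) (x0 + rho) (y0 - rho) (y0 + rho) _
  (fun p Bp => uc p (B0W p Bp)).
(* This makes the bump subharmonic outside the square of half-width [s0], in which |u|^2 is at least
   half its value at [p0]. *)
have [m Hm] := exists_large_nat (2 * rho ^+ 2 / s0 ^+ 2).
have ms : 2 * rho ^+ 2 <= (2 * m%:R + 3) * s0 ^+ 2.
  have s02 : 0 < s0 ^+ 2 by rewrite exprn_gt0.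
  rewrite -ler_pdivrMr//; apply: le_trans (ltW Hm) _.
  by have : 0 <= m%:R :> R by []; lra.
have mB0 : measurable B0 by exact: measurable_box.
have ulow (p : R * R) : B0 p -> `|p.1 - x0| < s0 -> `|p.2 - y0| < s0 ->
    (a p0 ^+ 2 + b p0 ^+ 2) / 2 <= a p ^+ 2 + b p ^+ 2.
  move=> _; rewrite x0E y0E => q1 q2; have := Hs p q1 q2.
  by rewrite ltr_norml => /andP[? _]; lra.
have uup (p : R * R) : B0 p -> a p ^+ 2 + b p ^+ 2 <= C0.
  by move=> Bp; exact: le_trans (ler_norm _) (HC0 p Bp).
have iQ0 : (lam2 R).-integrable B0 (EFin \o Q).
  by apply: integrableS iQ => //; exact: measurable_box.
have nQ0 : (lam2 R).-negligible [set p | B0 p /\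
    (ax p - bY p) ^+ 2 + (bx p + ay p) ^+ 2 != 4 * Q p * (a p ^+ 2 + b p ^+ 2)].
  by apply: negligibleS nQ => p [Bp ?]; split => //; exact: B0B.
have u02 : 0 < (a p0 ^+ 2 + b p0 ^+ 2) / 2 by rewrite divr_gt0.
have [K HK] := vanishing_order_bound oW Ca Cb rho0 (ltW s00) ms B0W u02 ulow uup Q0 iQ0 nQ0.
pose psi0 := ((7 / 16) * rho ^+ 2) ^+ m.+2 * ((7 / 16) * rho ^+ 2) ^+ m.+2.
have psi00 : 0 < psi0 by rewrite mulr_gt0 ?exprn_gt0// mulr_gt0 ?exprn_gt0//; lra.
(* [K] does not involve [N], so [N] can be chosen to violate the bound; the flatness constants of
   order [N.+3] and then [tau] are taken afterwards. *)
have [N HN] := exceeds_bound K psi00.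
have := HK p1.1 p1.2.
have [Ca' [da [Ca'0 da0 Ha]]] := fa N.+3.
have [Cb' [db [Cb'0 db0 Hb]]] := fb N.+3.
have E0 : 0 <= (Ca' ^+ 2 + Cb' ^+ 2) * 2 ^+ N.+3 * 2.
  by rewrite mulr_ge0// mulr_ge0 ?exprn_ge0// addr_ge0 ?sqr_ge0.
have [t1 t10 Ht1] := exists_small E0.
have [t2 [t20 t2a t2b]] := below_both da0 db0.
have [t3 [t30 t31 t32]] := below_both t10 t20.
(* With tau < rho / 2, the square about [p1] stays within rho / 2 + rho / 4 of [p0] in each
   coordinate, as [bump_lower] requires. *)
have [tau [tau0 tau1 tau2]] := below_both t30 (ltac:(by rewrite divr_gt0) : 0 < rho / 2).
move=> /(_ tau psi0 N tau0 (ltW psi00)) HK'.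
suff : psi0 * N.+2%:R / 2 <= K.
  by rewrite leNgt HN.
apply: HK'.
- move=> p /boxP [/andP[q1 q2] /andP[q3 q4]].
  have e1 : p1.1 - r1 <= p.1 <= p1.1 + r1.
    by apply/andP; move: q1 q2 h1 h1' rhoE; clear; split; lra.
  have e2 : p1.2 - r1 <= p.2 <= p1.2 + r1.
    by apply/andP; move: q3 q4 h2 h2' rhoE; clear; split; lra.
  have := sqr_diff_le e1; have := sqr_diff_le e2.
  have : r1 ^+ 2 <= (1 / 2) ^+ 2.
    by move: r10 r12; clear => *; rewrite ler_sqr ?nnegrE; lra.
  have : tau ^+ 2 <= (1 / 2) ^+ 2.
    by move: tau0 tau2 rhoE r12; clear => *; rewrite ler_sqr ?nnegrE; lra.
  by rewrite /wq; clear; lra.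
- move=> p /boxP [/andP[q1 q2] /andP[q3 q4]]; apply/boxP; split; apply/andP.
    by move: q1 q2 h1 h1' tau2 tau0; clear; split; lra.
  by move: q3 q4 h2 h2' tau2 tau0; clear; split; lra.
- move=> p Sp; have /boxP [/andP[q1 q2] /andP[q3 q4]] := Sp; split.
    have e1 : x0 - (3/4) * rho <= p.1 <= x0 + (3/4) * rho.
      by apply/andP; move: q1 q2 h1 h1' tau2 tau0; clear; split; lra.
    have e2 : y0 - (3/4) * rho <= p.2 <= y0 + (3/4) * rho.
      by apply/andP; move: q3 q4 h2 h2' tau2 tau0; clear; split; lra.
    exact: bump_lower.
  have lp : l1 p1 p <= tau.
    rewrite /l1; apply: (@le_trans _ _ (tau / 2 + tau / 2)); last by rewrite -splitr.
    by rewrite lerD// ler_norml; apply/andP; move: q1 q2 q3 q4; clear; split; lra.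
  have ltau : l1 p1 p < t2 by apply: le_lt_trans lp _; apply: lt_trans tau1 _.
  apply: (sqr_le_wg tau0 Ca'0 Cb'0) => //.
  + by apply: Ha; apply: lt_trans ltau _.
  + by apply: Hb; apply: lt_trans ltau _.
  + apply: le_trans Ht1; apply: ler_wpM2l => //.
    by rewrite ler_sqr ?nnegrE ?ltW//; apply: lt_trans tau1 _.
Qed.

(** * Orders of vanishing, smooth functions, powers of z - z0 *)

Section O_calculus.
Context {R : realType}.
Implicit Types (f g fx fy : R * R -> R) (p : R * R).

Lemma O_at_eq p0 k f g : (forall p, f p = g p) -> O_at p0 k f -> O_at p0 k g.
Proof. by move=> /funext ->. Qed.

Lemma O_atD p0 k f g : O_at p0 k f -> O_at p0 k g -> O_at p0 k (fun p => f p + g p).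
Proof.
move=> [C [c [C0 c0 Hf]]] [D [d [D0 d0 Hg]]]; have [e [e0 ec ed]] := below_both c0 d0.
exists (C + D), e; split; [exact: addr_ge0|by []|move=> p pe].
rewrite mulrDl; apply: le_trans (ler_normD _ _) _; apply: lerD.
  by apply: Hf; exact: lt_trans ec.
by apply: Hg; exact: lt_trans ed.
Qed.

Lemma O_atZ p0 k s f : O_at p0 k f -> O_at p0 k (fun p => s * f p).
Proof.
move=> [C [c [C0 c0 Hf]]]; exists (`|s| * C), c; split; [exact: mulr_ge0|by []|move=> p pc].
by rewrite normrM -mulrA ler_wpM2l//; exact: Hf.
Qed.

Lemma O_at0 p0 f : {for p0, continuous f} -> O_at p0 0 f.
Proof.
move=> fc; have [d d0 H] := continuous_pairP fc (@ltr01 R).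
exists (`|f p0| + 1), d; split; [by rewrite addr_ge0|by []|move=> p pd].
rewrite expr0 mulr1 -[f p](subrK (f p0)) addrC; apply: le_trans (ler_normD _ _) _.
rewrite lerD2l ltW// H//; apply: le_lt_trans pd; rewrite /l1.
  by rewrite lerDl.
by rewrite lerDr.
Qed.

(** The mean value estimate is applied along the horizontal segment from (x, y) to (x0, y) and then
    along the vertical one to (x0, y0); each length supplies the additional power. *)
Lemma O_at_int (W : set (R * R)) p0 k f fx fy : open W -> W p0 -> f p0 = 0 ->
  (forall x y, W (x, y) -> is_derive x 1 (fun t => f (t, y)) (fx (x, y))) ->
  (forall x y, W (x, y) -> is_derive y 1 (fun t => f (x, t)) (fy (x, y))) ->
  O_at p0 k fx -> O_at p0 k fy -> O_at p0 k.+1 f.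
Proof.
move=> oW Wp0 f0 f_x f_y [C [c [C0 c0 Hx]]] [D [d [D0 d0 Hy]]].
have /nbhs_pairP[r r0 Wr] : nbhs p0 W by exact: open_nbhs_nbhs.
have [e' [e'0 ec ed]] := below_both c0 d0; have [e [e0 ee' er]] := below_both e'0 r0.
exists (C + D), e; split; [exact: addr_ge0|by []|move=> p pe].
have lW q : l1 p0 q < e -> W q.
  move=> qe; apply: Wr; apply: le_lt_trans (lt_trans qe er); rewrite /l1.
    by rewrite lerDl.
  by rewrite lerDr.
case: p p0 f0 {Wp0 Wr} => [x y] [x0 y0] f0 in Hx Hy pe lW *.
have h1 : `|f (x, y) - f (x0, y)| <= C * l1 (x0, y0) (x, y) ^+ k * `|x - x0|.
  apply: (@mean_value_le R (fun t => f (t, y)) (fun t => fx (t, y))) => t tx.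
  have lt : l1 (x0, y0) (t, y) <= l1 (x0, y0) (x, y) by rewrite /l1/= lerD2r.
  have te := le_lt_trans lt pe.
  split; first exact: f_x (lW _ te).
  apply: le_trans (Hx _ (lt_trans te (lt_trans ee' ec))) _.
  by rewrite ler_wpM2l// lerXn2r ?nnegrE ?l1_ge0.
have h2 : `|f (x0, y) - f (x0, y0)| <= D * l1 (x0, y0) (x, y) ^+ k * `|y - y0|.
  apply: (@mean_value_le R (fun t => f (x0, t)) (fun t => fy (x0, t))) => t ty.
  have lt : l1 (x0, y0) (x0, t) <= l1 (x0, y0) (x, y).
    by rewrite /l1/= subrr normr0 add0r (le_trans ty)// lerDr.
  have te := le_lt_trans lt pe.
  split; first exact: f_y (lW _ te).
  apply: le_trans (Hy _ (lt_trans te (lt_trans ee' ed))) _.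
  by rewrite ler_wpM2l// lerXn2r ?nnegrE ?l1_ge0.
rewrite f0 subr0 in h2; rewrite -[f (x, y)](subrK (f (x0, y))).
apply: le_trans (ler_normD _ _) _.
have lk : 0 <= l1 (x0, y0) (x, y) ^+ k by rewrite exprn_ge0// l1_ge0.
rewrite mulrDl; apply: lerD; [apply: le_trans h1 _|apply: le_trans h2 _].
  by rewrite exprSr mulrA ler_wpM2l ?mulr_ge0// /l1 lerDl.
by rewrite exprSr mulrA ler_wpM2l ?mulr_ge0// /l1 lerDr.
Qed.

End O_calculus.

Definition smooth (R : realType) (W : set (R * R)) (f : R * R -> R) : Prop :=
  forall k, Ck_on k W f.

Section smooth_functions.
Context {R : realType}.
Variables (W : set (R * R)).
Hypothesis oW : open W.
Implicit Types (f g : R * R -> R) (p : R * R).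

Lemma smooth_cont f p : smooth W f -> W p -> {for p, continuous f}.
Proof. by move=> /(_ 0%N)[+ _]; exact. Qed.

Lemma smooth_D1 f : smooth W f -> smooth W ('D_(e1 R) f).
Proof. by move=> sf k; have [_ []] := sf k.+1. Qed.

Lemma smooth_D2 f : smooth W f -> smooth W ('D_(e2 R) f).
Proof. by move=> sf k; have [_ []] := sf k.+1. Qed.

Lemma smooth_der1 f x y : smooth W f -> W (x, y) ->
  is_derive x 1 (fun t => f (t, y)) ('D_(e1 R) f (x, y)).
Proof.
move=> /(_ 1%N)[_ [/= + _ _]] => /[apply] -[fd _].
have E : (fun h : R => h^-1 *: (f (h *: e1 R + (x, y)) - f (x, y))) =
         (fun h : R => h^-1 *: (f (h *: 1 + x, y) - f (x, y))).
  apply/funext => h; congr (_ *: (f _ - _)).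
  by rewrite (_ : _ + _ = (h *: 1 + x, h *: 0 + y))// scaler0 add0r.
rewrite /derivable E in fd; apply: DeriveDef; first exact: fd.
by rewrite /derive E.
Qed.

Lemma smooth_der2 f x y : smooth W f -> W (x, y) ->
  is_derive y 1 (fun t => f (x, t)) ('D_(e2 R) f (x, y)).
Proof.
move=> /(_ 1%N)[_ [/= + _ _]] => /[apply] -[_ fd].
have E : (fun h : R => h^-1 *: (f (h *: e2 R + (x, y)) - f (x, y))) =
         (fun h : R => h^-1 *: (f (x, h *: 1 + y) - f (x, y))).
  apply/funext => h; congr (_ *: (f _ - _)).
  by rewrite (_ : _ + _ = (h *: 0 + x, h *: 1 + y))// scaler0 add0r.
rewrite /derivable E in fd; apply: DeriveDef; first exact: fd.
by rewrite /derive E.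
Qed.

Lemma smooth_mixed f p : smooth W f -> W p ->
  'D_(e2 R) ('D_(e1 R) f) p = 'D_(e1 R) ('D_(e2 R) f) p.
Proof.
move=> sf Wp.
have sx := smooth_D1 sf; have sy := smooth_D2 sf.
exact: (mixed_partials oW Wp (fun x y => @smooth_der1 f x y sf)
  (fun x y => @smooth_der2 f x y sf) (fun x y => @smooth_der2 _ x y sx)
  (fun x y => @smooth_der1 _ x y sy) (smooth_cont (smooth_D2 sx) Wp)
  (smooth_cont (smooth_D1 sy) Wp)).
Qed.

Lemma smooth_C2 f : smooth W f ->
  C2_on W f ('D_(e1 R) f) ('D_(e2 R) f) ('D_(e2 R) ('D_(e1 R) f)).
Proof.
move=> sf; split=> [p|p|p|p|x y|x y|x y|x y] Wp.
- exact: smooth_cont.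
- exact/smooth_cont/Wp/smooth_D1.
- exact/smooth_cont/Wp/smooth_D2.
- exact/smooth_cont/Wp/smooth_D2/smooth_D1.
- exact: smooth_der1.
- exact: smooth_der2.
- exact/smooth_der2/Wp/smooth_D1.
- rewrite (smooth_mixed sf Wp).
  exact: (@smooth_der1 ('D_(e2 R) f) x y (smooth_D2 sf) Wp).
Qed.

Lemma cont_closure_zero (S : set (R * R)) f p : {for p, continuous f} ->
  closure S p -> (forall q, S q -> f q = 0) -> f p = 0.
Proof.
move=> fc Sp f0; apply/eqP/negPn/negP => fp.
have np : nbhs p [set q | f q != 0] by exact: (cvgr_neq0 _ fc fp).
by have [q [/f0 fq /=]] := Sp _ np; rewrite fq eqxx.
Qed.

Lemma derive_eq_on (S : set (R * R)) f g v p : open S -> S p ->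
  (forall q, S q -> f q = g q) -> 'D_v f p = 'D_v g p.
Proof.
move=> oS Sp fg; apply: near_eq_derive.
by apply: filterS (open_nbhs_nbhs (conj oS Sp)) => q; exact: fg.
Qed.

End smooth_functions.

(** Equality on the open set [S] passes to the partial derivatives, and by continuity to the limit
    point [p0]; [O_at_int] then raises the order. The factor [s] is 1 or -1 for the Cauchy-Riemann
    equations and 0 for a function vanishing on [S]. *)
Lemma flat_of_eq (R : realType) (W S : set (R * R)) (p0 : R * R) (s : R) (f g : R * R -> R) :
  open W -> open S -> S `<=` W -> W p0 -> closure S p0 -> smooth W f -> smooth W g ->
  (forall p, S p -> f p = s * g p) -> flat_at p0 (fun p => f p - s * g p).
Proof.
move=> oW oS SW Wp0 Sp0 + + + k; elim: k f g => [|k IH] f g sf sg fg.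
  apply: O_at0; have fc := smooth_cont sf Wp0; have gc := smooth_cont sg Wp0.
  by cont.
have gder1 x y : W (x, y) -> is_derive x 1 (fun t => f (t, y) - s * g (t, y))
    ('D_(e1 R) f (x, y) - s * 'D_(e1 R) g (x, y)).
  move=> Wp; refine (is_der_eq (is_derB (smooth_der1 sf Wp)
    (is_derM (is_der_cst s x) (smooth_der1 sg Wp))) _).
  by rewrite mul0r add0r.
have gder2 x y : W (x, y) -> is_derive y 1 (fun t => f (x, t) - s * g (x, t))
    ('D_(e2 R) f (x, y) - s * 'D_(e2 R) g (x, y)).
  move=> Wp; refine (is_der_eq (is_derB (smooth_der2 sf Wp)
    (is_derM (is_der_cst s y) (smooth_der2 sg Wp))) _).
  by rewrite mul0r add0r.
have DS v p : S p -> derivable g p v -> 'D_v f p = s * 'D_v g p.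
  move=> Sp gd; rewrite (derive_eq_on v oS Sp fg).
  by rewrite (@deriveZ _ _ _ g s).
apply: (@O_at_int R W p0 k (fun p => f p - s * g p)
  (fun p => 'D_(e1 R) f p - s * 'D_(e1 R) g p) (fun p => 'D_(e2 R) f p - s * 'D_(e2 R) g p)) => //.
- apply: (@cont_closure_zero _ S (fun p => f p - s * g p)) => //.
    have fc := smooth_cont sf Wp0; have gc := smooth_cont sg Wp0.
    by cont.
  by move=> q Sq; rewrite fg// subrr.
- apply: IH; [exact: smooth_D1|exact: smooth_D1|move=> p Sp].
  by apply: DS => //; have [_ [/= /(_ p (SW _ Sp))[]]] := sg 1%N.
- apply: IH; [exact: smooth_D2|exact: smooth_D2|move=> p Sp].
  by apply: DS => //; have [_ [/= /(_ p (SW _ Sp))[]]] := sg 1%N.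
Qed.

(* Real and imaginary parts of [(z - z0) ^+ k]. *)
Fixpoint zpow (R : realType) (p0 : R * R) (k : nat) (p : R * R) : R * R :=
  if k is k'.+1 then
    let w := zpow p0 k' p in
    (w.1 * (p.1 - p0.1) - w.2 * (p.2 - p0.2), w.1 * (p.2 - p0.2) + w.2 * (p.1 - p0.1))
  else (1, 0).

Section zpow.
Context {R : realType}.
Variable p0 : R * R.

Lemma is_der_zpow_x k (x y : R) :
  is_derive x 1 (fun t : R => (zpow p0 k.+1 (t, y)).1) (k.+1%:R * (zpow p0 k (x, y)).1) /\
  is_derive x 1 (fun t : R => (zpow p0 k.+1 (t, y)).2) (k.+1%:R * (zpow p0 k (x, y)).2).
Proof.
have dx : is_derive x 1 (fun t => t - p0.1) (1 - 0) := is_derB (is_der_id x) (is_der_cst _ x).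
have dy : is_derive x 1 (fun _ => y - p0.2) 0 := is_der_cst _ x.
elim: k => [|k [IH1 IH2]].
  split => /=.
    by refine (is_der_eq (is_derB (is_derM (is_der_cst _ _) dx) (is_derM (is_der_cst _ _) dy)) _); ring.
  by refine (is_der_eq (is_derD (is_derM (is_der_cst _ _) dy) (is_derM (is_der_cst _ _) dx)) _); ring.
split.
  refine (is_der_eq (is_derB (is_derM IH1 dx) (is_derM IH2 dy)) _).
  by rewrite -[k.+2%:R]natr1 /=; ring.
refine (is_der_eq (is_derD (is_derM IH1 dy) (is_derM IH2 dx)) _).
by rewrite -[k.+2%:R]natr1 /=; ring.
Qed.

Lemma is_der_zpow_y k (x y : R) :
  is_derive y 1 (fun t : R => (zpow p0 k.+1 (x, t)).1) (- (k.+1%:R * (zpow p0 k (x, y)).2)) /\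
  is_derive y 1 (fun t : R => (zpow p0 k.+1 (x, t)).2) (k.+1%:R * (zpow p0 k (x, y)).1).
Proof.
have dx : is_derive y 1 (fun _ => x - p0.1) 0 := is_der_cst _ y.
have dy : is_derive y 1 (fun t => t - p0.2) (1 - 0) := is_derB (is_der_id y) (is_der_cst _ y).
elim: k => [|k [IH1 IH2]].
  split => /=.
    by refine (is_der_eq (is_derB (is_derM (is_der_cst _ _) dx) (is_derM (is_der_cst _ _) dy)) _); ring.
  by refine (is_der_eq (is_derD (is_derM (is_der_cst _ _) dy) (is_derM (is_der_cst _ _) dx)) _); ring.
split.
  refine (is_der_eq (is_derB (is_derM IH1 dx) (is_derM IH2 dy)) _).
  by rewrite -[k.+2%:R]natr1 /=; ring.
refine (is_der_eq (is_derD (is_derM IH1 dy) (is_derM IH2 dx)) _).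
by rewrite -[k.+2%:R]natr1 /=; ring.
Qed.

Lemma zpow_center k : zpow p0 k.+1 p0 = (0, 0).
Proof. by elim: k => [|k IH] /=; rewrite !subrr !mulr0 addr0 ?subr0. Qed.

End zpow.

(** * Dichotomy for a + i b: leading term (c + i d) (z - z0)^j, or flatness *)

Definition lead_at (R : realType) (p0 : R * R) (j : nat) (c d : R) (a b : R * R -> R) : Prop :=
  O_at p0 j.+1 (fun p => a p - (c * (zpow p0 j p).1 - d * (zpow p0 j p).2)) /\
  O_at p0 j.+1 (fun p => b p - (c * (zpow p0 j p).2 + d * (zpow p0 j p).1)).

Section dichotomy.
Context {R : realType}.
Variables (W S : set (R * R)) (p0 : R * R).
Hypotheses (oW : open W) (oS : open S) (SW : S `<=` W) (Wp0 : W p0) (Sp0 : closure S p0).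

Let CR (a b : R * R -> R) := [/\ smooth W a, smooth W b,
  forall p, S p -> 'D_(e2 R) b p = 'D_(e1 R) a p &
  forall p, S p -> 'D_(e2 R) a p = - 'D_(e1 R) b p].

(** By symmetry of the mixed derivatives. It allows the expansion at [p0] to be explored through
    x-derivatives alone. *)
Let CR_D1 a b : CR a b -> CR ('D_(e1 R) a) ('D_(e1 R) b).
Proof.
move=> [sa sb h1 h2]; split; [exact: smooth_D1|exact: smooth_D1|move=> p Sp|move=> p Sp].
  rewrite (smooth_mixed oW sb (SW Sp)).
  exact: derive_eq_on oS Sp h1.
rewrite (smooth_mixed oW sa (SW Sp)) (derive_eq_on _ oS Sp h2).
have [_ [/= /(_ p (SW Sp))[d _] _ _]] := smooth_D1 sb 1%N.
by rewrite (@deriveN _ _ _ ('D_(e1 R) b)).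
Qed.

(** Off [S] the Cauchy-Riemann equations may fail, but only by a flat error at [p0]; in expansions
    there, a y-derivative may be replaced by i times the x-derivative. *)
Let CR_flat a b : CR a b ->
  flat_at p0 (fun p => 'D_(e2 R) b p - 'D_(e1 R) a p) /\
  flat_at p0 (fun p => 'D_(e2 R) a p + 'D_(e1 R) b p).
Proof.
move=> [sa sb h1 h2]; split=> k.
  have H := @flat_of_eq R W S p0 1 _ _ oW oS SW Wp0 Sp0 (smooth_D2 sb) (smooth_D1 sa).
  by apply: O_at_eq (H _ k) => p; rewrite mul1r//; exact: h1.
have H := @flat_of_eq R W S p0 (-1) _ _ oW oS SW Wp0 Sp0 (smooth_D2 sa) (smooth_D1 sb).
by apply: O_at_eq (H _ k) => p; rewrite mulN1r ?opprK//; exact: h2.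
Qed.

Let lead_int a b j c d : CR a b -> a p0 = 0 -> b p0 = 0 ->
  lead_at p0 j c d ('D_(e1 R) a) ('D_(e1 R) b) ->
  lead_at p0 j.+1 (c / j.+1%:R) (d / j.+1%:R) a b.
Proof.
move=> CRab a0 b0 [La Lb]; have [sa sb h1 h2] := CRab; have [F1 F2] := CR_flat CRab.
have j0 : j.+1%:R != 0 :> R by rewrite pnatr_eq0.
split.
  apply: (@O_at_int R W p0 j.+1 _ (fun p => 'D_(e1 R) a p -
    (c * (zpow p0 j p).1 - d * (zpow p0 j p).2)) (fun p => 'D_(e2 R) a p -
    (- c * (zpow p0 j p).2 - d * (zpow p0 j p).1))) => //.
  - by rewrite zpow_center a0 !mulr0 !subr0.
  - move=> x y Wp; have [z1 z2] := is_der_zpow_x p0 j x y.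
    refine (is_der_eq (is_derB (smooth_der1 sa Wp) (is_derB (is_derM (is_der_cst _ _) z1)
      (is_derM (is_der_cst _ _) z2))) _).
    by field.
  - move=> x y Wp; have [z1 z2] := is_der_zpow_y p0 j x y.
    refine (is_der_eq (is_derB (smooth_der2 sa Wp) (is_derB (is_derM (is_der_cst _ _) z1)
      (is_derM (is_der_cst _ _) z2))) _).
    by field.
  - by apply: O_at_eq (O_atD (F2 j.+1) (O_atZ (-1) Lb)) => p; ring.
apply: (@O_at_int R W p0 j.+1 _ (fun p => 'D_(e1 R) b p -
  (c * (zpow p0 j p).2 + d * (zpow p0 j p).1)) (fun p => 'D_(e2 R) b p -
  (c * (zpow p0 j p).1 - d * (zpow p0 j p).2))) => //.
- by rewrite zpow_center b0 !mulr0 !addr0 subr0.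
- move=> x y Wp; have [z1 z2] := is_der_zpow_x p0 j x y.
  refine (is_der_eq (is_derB (smooth_der1 sb Wp) (is_derD (is_derM (is_der_cst _ _) z2)
    (is_derM (is_der_cst _ _) z1))) _).
  by field.
- move=> x y Wp; have [z1 z2] := is_der_zpow_y p0 j x y.
  refine (is_der_eq (is_derB (smooth_der2 sb Wp) (is_derD (is_derM (is_der_cst _ _) z2)
    (is_derM (is_der_cst _ _) z1))) _).
  by field.
- by apply: O_at_eq (O_atD (F1 j.+1) La) => p; ring.
Qed.

Let O_int a b k : CR a b -> a p0 = 0 -> b p0 = 0 ->
  O_at p0 k ('D_(e1 R) a) -> O_at p0 k ('D_(e1 R) b) -> O_at p0 k.+1 a /\ O_at p0 k.+1 b.
Proof.
move=> CRab a0 b0 La Lb; have [sa sb h1 h2] := CRab; have [F1 F2] := CR_flat CRab.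
split.
  refine (@O_at_int R W p0 k a ('D_(e1 R) a) ('D_(e2 R) a) oW Wp0 a0
    (fun x y => @smooth_der1 _ _ a x y sa)
    (fun x y => @smooth_der2 _ _ a x y sa) La _).
  by apply: O_at_eq (O_atD (F2 k) (O_atZ (-1) Lb)) => p; ring.
refine (@O_at_int R W p0 k b ('D_(e1 R) b) ('D_(e2 R) b) oW Wp0 b0
  (fun x y => @smooth_der1 _ _ b x y sb)
  (fun x y => @smooth_der2 _ _ b x y sb) Lb _).
by apply: O_at_eq (O_atD (F1 k) La) => p; ring.
Qed.

(** A nonzero value at [p0] is itself a leading term of degree 0. Otherwise the alternative for the
    x-derivative is integrated once. The finite order [k] is what makes an induction possible. *)
Let lead_or_O k a b : CR a b ->
  (exists j c d, (c, d) != (0, 0) /\ lead_at p0 j c d a b) \/ (O_at p0 k a /\ O_at p0 k b).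
Proof.
elim: k a b => [|k IH] a b CRab; have [sa sb h1 h2] := CRab.
  by right; split; apply: O_at0; exact: smooth_cont Wp0.
have [ab0|ab0] := eqVneq (a p0, b p0) (0, 0); last first.
  left; exists 0%N, (a p0), (b p0); split => //; split => /=.
    apply: (@O_at_int R W p0 0 _ ('D_(e1 R) a) ('D_(e2 R) a)) => //.
    - by rewrite mulr1 mulr0 subr0 subrr.
    - move=> x y Wp; refine (is_der_eq (is_derB (smooth_der1 sa Wp) (is_der_cst _ _)) _).
      by rewrite subr0.
    - move=> x y Wp; refine (is_der_eq (is_derB (smooth_der2 sa Wp) (is_der_cst _ _)) _).
      by rewrite subr0.
    - exact/O_at0/smooth_cont/Wp0/smooth_D1.
    - exact/O_at0/smooth_cont/Wp0/smooth_D2.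
  apply: (@O_at_int R W p0 0 _ ('D_(e1 R) b) ('D_(e2 R) b)) => //.
  - by rewrite mulr1 mulr0 add0r subrr.
  - move=> x y Wp; refine (is_der_eq (is_derB (smooth_der1 sb Wp) (is_der_cst _ _)) _).
    by rewrite subr0.
  - move=> x y Wp; refine (is_der_eq (is_derB (smooth_der2 sb Wp) (is_der_cst _ _)) _).
    by rewrite subr0.
  - exact/O_at0/smooth_cont/Wp0/smooth_D1.
  - exact/O_at0/smooth_cont/Wp0/smooth_D2.
case: ab0 => a0 b0.
have [[j [c [d [cd0 L]]]]|[Oa Ob]] := IH _ _ (CR_D1 CRab); last by right; exact: O_int.
left; exists j.+1, (c / j.+1%:R), (d / j.+1%:R); split; last exact: lead_int.
apply: contra cd0 => /eqP[/eqP + /eqP]; rewrite !mulf_eq0 !invr_eq0 !pnatr_eq0 !orbF.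
by move=> /eqP -> /eqP ->.
Qed.

(** Excluded middle on the existence of a leading term turns the finite alternatives of [lead_or_O]
    into flatness. The leading term of the x-derivative is kept because del u is compared with
    it. *)
Lemma flat_or_lead a b : smooth W a -> smooth W b ->
  (forall p, S p -> 'D_(e2 R) b p = 'D_(e1 R) a p) ->
  (forall p, S p -> 'D_(e2 R) a p = - 'D_(e1 R) b p) ->
  a p0 = 0 -> b p0 = 0 ->
  (flat_at p0 a /\ flat_at p0 b) \/
  exists j c d, [/\ (c, d) != (0, 0), lead_at p0 j c d ('D_(e1 R) a) ('D_(e1 R) b) &
     lead_at p0 j.+1 (c / j.+1%:R) (d / j.+1%:R) a b].
Proof.
move=> sa sb h1 h2 a0 b0; have CRab : CR a b by split.
have [[j [c [d [cd0 L]]]]|nL] := pselect (exists j c d, (c, d) != (0, 0) /\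
    lead_at p0 j c d ('D_(e1 R) a) ('D_(e1 R) b)).
  by right; exists j, c, d; split => //; exact: lead_int.
have H k : O_at p0 k ('D_(e1 R) a) /\ O_at p0 k ('D_(e1 R) b).
  by have [|] := lead_or_O k (CR_D1 CRab).
left; split=> -[|k]; [exact/O_at0/smooth_cont/Wp0| |exact/O_at0/smooth_cont/Wp0|].
  by have [Oa Ob] := H k; have [] := O_int CRab a0 b0 Oa Ob.
by have [Oa Ob] := H k; have [] := O_int CRab a0 b0 Oa Ob.
Qed.

Lemma cauchy_riemann_defect_flat a b : smooth W a -> smooth W b ->
  (forall p, S p -> 'D_(e2 R) b p = 'D_(e1 R) a p) ->
  (forall p, S p -> 'D_(e2 R) a p = - 'D_(e1 R) b p) ->
  flat_at p0 (fun p => 'D_(e2 R) b p - 'D_(e1 R) a p) /\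
  flat_at p0 (fun p => 'D_(e2 R) a p + 'D_(e1 R) b p).
Proof. by move=> sa sb h1 h2; apply: CR_flat; split. Qed.

End dichotomy.

Section lead_bounds.
Context {R : realType}.
Variable p0 : R * R.
Implicit Types (a b f g : R * R -> R) (p : R * R).

Definition r2 p : R := (p.1 - p0.1) ^+ 2 + (p.2 - p0.2) ^+ 2.

Lemma r2_ge0 p : 0 <= r2 p.
Proof. by rewrite addr_ge0 ?sqr_ge0. Qed.

Lemma l1_r2 p : r2 p <= l1 p0 p ^+ 2 <= 2 * r2 p.
Proof.
rewrite /l1 /r2 -(real_normK (num_real (p.1 - p0.1))) -(real_normK (num_real (p.2 - p0.2))).
have := sqr_ge0 (`|p.1 - p0.1| - `|p.2 - p0.2|).
have := mulr_ge0 (normr_ge0 (p.1 - p0.1)) (normr_ge0 (p.2 - p0.2)).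
by move=> h1 h2; apply/andP; split; lra.
Qed.

Lemma zpow_norm k p : (zpow p0 k p).1 ^+ 2 + (zpow p0 k p).2 ^+ 2 = r2 p ^+ k.
Proof.
elim: k => [|k IH] /=; first by rewrite !expr0 expr1n expr0n addr0.
by rewrite [r2 p ^+ k.+1]exprS -IH /r2; ring.
Qed.

(** The additional power of the distance is spent on making the constant as small as desired. *)
Lemma O_at_small k f (m : R) : O_at p0 k.+1 f -> 0 < m ->
  exists2 d : R, 0 < d & forall p, l1 p0 p < d -> f p ^+ 2 <= m * r2 p ^+ k.
Proof.
move=> [C [c [C0 c0 H]]] m0.
pose E := C ^+ 2 * 2 ^+ k.+1 / m.
have E0 : 0 <= E by rewrite divr_ge0 ?(ltW m0)// mulr_ge0 ?sqr_ge0 ?exprn_ge0.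
have [e e0 He] := exists_small E0; have [d [d0 dc de]] := below_both c0 e0.
exists d => // p pd; have lc := lt_trans pd dc.
have /andP[_ l2] := l1_r2 p; have r0 := r2_ge0 p; have l0 := l1_ge0 p0 p.
rewrite -(real_normK (num_real (f p))).
apply: (@le_trans _ _ ((C * l1 p0 p ^+ k.+1) ^+ 2)).
  by rewrite ler_sqr ?nnegrE ?H// mulr_ge0// exprn_ge0.
have -> : (C * l1 p0 p ^+ k.+1) ^+ 2 = C ^+ 2 * l1 p0 p ^+ 2 * (l1 p0 p ^+ 2) ^+ k.
  by rewrite exprMn [(_ ^+ k.+1) ^+ 2]exprAC [(_ ^+ 2) ^+ k.+1]exprS mulrA.
have le2 : l1 p0 p ^+ 2 <= e ^+ 2.
  by rewrite ler_sqr ?nnegrE ?(ltW e0)// ltW// (lt_trans pd de).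
apply: (@le_trans _ _ (C ^+ 2 * e ^+ 2 * (2 * r2 p) ^+ k)).
  apply: ler_pM; rewrite ?mulr_ge0 ?sqr_ge0 ?exprn_ge0 ?sqr_ge0//.
    by rewrite ler_wpM2l ?sqr_ge0.
  by apply: lerXn2r; rewrite ?nnegrE ?sqr_ge0// mulr_ge0.
have rk : 0 <= r2 p ^+ k by rewrite exprn_ge0.
rewrite exprMn mulrA ler_wpM2r//.
apply: (@le_trans _ _ (m * (E * e ^+ 2))); last by rewrite ler_piMr ?(ltW m0).
rewrite /E (_ : m * _ = C ^+ 2 * e ^+ 2 * 2 ^+ k * 2).
  apply: ler_peMr; last by rewrite ler1n.
  by apply: mulr_ge0; [apply: mulr_ge0; exact: sqr_ge0|exact: exprn_ge0].
by rewrite [2 ^+ k.+1]exprS; move: (2 ^+ k) => t; field; rewrite gt_eqF.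
Qed.

(** The two squared errors are each at most 1/8 of the squared leading term, so the total error is
    at most half of that term; this yields the factors 1/4 and 4. *)
Lemma lead_bounds j (c d : R) a b : (c, d) != (0, 0) -> lead_at p0 j c d a b ->
  exists m M e : R, [/\ 0 < m, 0 < M, 0 < e & forall p, l1 p0 p < e ->
    m * r2 p ^+ j <= a p ^+ 2 + b p ^+ 2 <= M * r2 p ^+ j].
Proof.
move=> cd0 [La Lb].
have k0 : 0 < c ^+ 2 + d ^+ 2.
  rewrite lt_neqAle addr_ge0 ?sqr_ge0// andbT; apply: contra cd0 => /eqP/esym/eqP.
  by rewrite paddr_eq0 ?sqr_ge0// !expf_eq0/= => /andP[/eqP -> /eqP ->].
have k8 : 0 < (c ^+ 2 + d ^+ 2) / 8 by lra.
have [ea ea0 Ha] := O_at_small La k8; have [eb eb0 Hb] := O_at_small Lb k8.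
have [e [e0 ea' eb']] := below_both ea0 eb0.
exists ((c ^+ 2 + d ^+ 2) / 4), (4 * (c ^+ 2 + d ^+ 2)), e; split => //; [lra|lra|].
move=> p pe; have := Ha p (lt_trans pe ea'); have := Hb p (lt_trans pe eb').
have := zpow_norm j p; have : 0 <= r2 p ^+ j by rewrite exprn_ge0// r2_ge0.
move: (zpow p0 j p) (r2 p ^+ j) (a p) (b p) => [x y] r A B /= r0 xy.
move=> hb ha.
have E : (c * x - d * y) ^+ 2 + (c * y + d * x) ^+ 2 = (c ^+ 2 + d ^+ 2) * r by rewrite -xy; ring.
have kr : 0 <= (c ^+ 2 + d ^+ 2) * r by rewrite mulr_ge0// ltW.
move: (c * x - d * y) (c * y + d * x) E ha hb kr; clear => X Y E ha hb kr.
have := sqr_ge0 (A - 2 * X); have := sqr_ge0 (B - 2 * Y).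
have := sqr_ge0 (2 * A - X); have := sqr_ge0 (2 * B - Y).
by move=> *; apply/andP; split; lra.
Qed.

End lead_bounds.

(** * The complex plane as R * R, and the Cauchy-Riemann equations *)

Section plane.
Context {R : realType}.
Implicit Types (z w : CC R) (p : R * R).

Lemma plane_to_CK p : C_to_plane (plane_to_C p) = p.
Proof. by case: p. Qed.

Lemma C_to_planeK z : plane_to_C (C_to_plane z) = z.
Proof. by case: z. Qed.

Lemma absC_sub z w : absC (w - z) = Num.sqrt
  ((complex.Re w - complex.Re z) ^+ 2 + (complex.Im w - complex.Im z) ^+ 2).
Proof. by case: z w => [a b] [c d]. Qed.

Lemma absC_sqr z : absC z ^+ 2 = complex.Re z ^+ 2 + complex.Im z ^+ 2.
Proof.
have -> : absC z = Num.sqrt (complex.Re z ^+ 2 + complex.Im z ^+ 2) by case: z.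
by rewrite sqr_sqrtr// addr_ge0 ?sqr_ge0.
Qed.

Lemma nbhs_absC z (A : set (CC R)) :
  nbhs z A <-> exists2 e : R, 0 < e & forall w, absC (w - z) < e -> A w.
Proof.
have ballE (e : R[i]) w : ball z e w = ((`|z - w| : R[i]) < e) by rewrite -ball_normE.
have distC w : absC (z - w) = absC (w - z).
  by rewrite !absC_sub; congr Num.sqrt; congr (_ + _); rewrite -sqrrN opprB.
split=> [/nbhs_ballP[e /= e0 eA]|[e e0 eA]].
  (* In the partial order of [R[i]] a positive radius has imaginary part 0. *)
  move: e0; rewrite ltcE /= => /andP[/eqP Ie0 Re0].
  exists (complex.Re e) => // w zw; apply: eA; rewrite ballE ltcE /= Ie0 eqxx /=.
  by rewrite -distC in zw.
apply/nbhs_ballP; exists (e%:C)%C; first by rewrite /= ltcE /= eqxx.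
move=> w; rewrite ballE ltcE /= => /andP[_ zw]; apply: eA.
by rewrite -distC.
Qed.

Lemma open_plane (A : set (CC R)) : open A -> open (@plane_to_C R @^-1` A).
Proof.
move=> oA; rewrite openE => p Ap.
have /nbhs_absC[e e0 eA] : nbhs (plane_to_C p) A by exact: open_nbhs_nbhs.
apply/nbhs_pairP; exists (e / 2); first by rewrite divr_gt0.
move=> q h1 h2; apply: eA; rewrite absC_sub /=.
rewrite -[ltRHS]ger0_norm ?(ltW e0)// -sqrtr_sqr ltr_sqrt ?exprn_gt0//.
have := real_normK (num_real (q.1 - p.1)); have := real_normK (num_real (q.2 - p.2)).
move: (normr_ge0 (q.1 - p.1)) (normr_ge0 (q.2 - p.2)); nra.
Qed.

Lemma open_C (B : set (R * R)) : open B -> open (@C_to_plane R @^-1` B).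
Proof.
move=> oB; rewrite openE => z Bz.
have /nbhs_pairP[e e0 eB] : nbhs (C_to_plane z) B by exact: open_nbhs_nbhs.
apply/nbhs_absC; exists e => // w zw; apply: eB; apply: le_lt_trans zw; rewrite absC_sub /=.
  by rewrite -sqrtr_sqr ler_wsqrtr// lerDl sqr_ge0.
by rewrite -sqrtr_sqr ler_wsqrtr// lerDr sqr_ge0.
Qed.

Lemma closure_plane (A : set (CC R)) z : closure A z ->
  closure (@plane_to_C R @^-1` A) (C_to_plane z).
Proof.
move=> Az B; rewrite nbhsE => -[C [oC Cz] CB].
have /Az[w [Aw Cw]] : nbhs z (@C_to_plane R @^-1` C).
  by apply: open_nbhs_nbhs; split => //; exact: open_C.
exists (C_to_plane w); split; first by rewrite /= C_to_planeK.
exact: CB.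
Qed.

End plane.

Lemma is_der_limit (R : realType) (f : R -> R) (x d l : R) : is_derive x 1 f d ->
  (forall e, 0 < e -> exists2 r, 0 < r & forall t, t != 0 -> `|t| < r ->
     `|t^-1 * (f (t + x) - f x) - l| < e) -> d = l.
Proof.
move=> [fx fd] H.
have cd : (fun h => h^-1 *: (f (h *: 1 + x) - f x)) @ 0^' --> d by rewrite -fd; exact: fx.
have cl : (fun h => h^-1 *: (f (h *: 1 + x) - f x)) @ 0^' --> l.
  apply/cvgrPdist_lt => e e0; have [r r0 Hr] := H e e0.
  exists r => // t /=; rewrite sub0r normrN => tr t0.
  by rewrite distrC [t *: 1]mulr1; exact: Hr.
exact: (cvg_unique _ cd cl).
Qed.

Section cauchy_riemann.
Context {R : realType}.
Implicit Types (z h l : CC R) (f : CC R -> CC R).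

Lemma absC_Re z : `|complex.Re z| <= absC z.
Proof.
by case: z => a b; rewrite /absC /= -sqrtr_sqr ler_wsqrtr// lerDl sqr_ge0.
Qed.

Lemma absC_Im z : `|complex.Im z| <= absC z.
Proof.
by case: z => a b; rewrite /absC /= -sqrtr_sqr ler_wsqrtr// lerDr sqr_ge0.
Qed.

Lemma derivable_absC f z : derivable f z (1 : CC R) -> exists l, forall e, 0 < e ->
  exists2 r, 0 < r & forall h, h != 0 -> absC h < r ->
    absC (h^-1 * (f (h + z) - f z) - l) < e.
Proof.
move=> /cvg_ex[/= l fl]; exists l => e e0.
have e0' : 0 < (e%:C)%C by rewrite ltcE /= eqxx.
have /cvgrPdist_lt/(_ _ e0')[r /= r0 Hr] := fl.
move: r0; rewrite ltcE /= => /andP[/eqP Ir0 Rr0].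
exists (complex.Re r) => // h h0 hr.
have := Hr h; rewrite /= sub0r normrN ltcE /= Ir0 eqxx => /(_ hr h0).
rewrite ltcE /= => /andP[_]; rewrite -[X in X < _ -> _]/(absC _).
have -> : absC (l - h^-1 *: (f (h *: 1 + z) - f z)) = absC (h^-1 * (f (h + z) - f z) - l).
  rewrite [h *: 1]mulr1 /absC; congr complex.Re; exact: distrC.
by [].
Qed.

(** The limit l of the complex difference quotient is ax + i bx along real increments and bY - i aY
    along imaginary ones. *)
Lemma cauchy_riemann f (x y ax bx aY bY : R) :
  derivable f (x +i* y)%C (1 : CC R) ->
  is_derive x 1 (fun t => re_part f (t, y)) ax ->
  is_derive x 1 (fun t => im_part f (t, y)) bx ->
  is_derive y 1 (fun t => re_part f (x, t)) aY ->
  is_derive y 1 (fun t => im_part f (x, t)) bY ->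
  bY = ax /\ aY = - bx.
Proof.
move=> /derivable_absC[l Hl] dax dbx day dby.
have invx (t : R) : (t +i* 0)%C^-1 = (t^-1 +i* 0)%C :> R[i].
  have [->|t0] := eqVneq t 0; first by rewrite !invr0.
  by apply: (mulfI (_ : (t +i* 0)%C != 0)); rewrite ?mulfV ?eq_complex /= ?eqxx ?andbT//;
     [rewrite /GRing.mul /= !mulr0 !mul0r subr0 addr0 mulfV| ..].
have invy (t : R) : (0 +i* t)%C^-1 = (0 +i* - t^-1)%C :> R[i].
  have [->|t0] := eqVneq t 0; first by rewrite !invr0 oppr0.
  by apply: (mulfI (_ : (0 +i* t)%C != 0)); rewrite ?mulfV ?eq_complex /= ?eqxx ?andTb//;
     [rewrite /GRing.mul /= mulrN mulfV// !mul0r !mulr0 sub0r opprK addr0| ..].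
have Hx (e : R) : 0 < e -> exists2 r, 0 < r & forall t : R, t != 0 -> `|t| < r ->
    absC ((t^-1 +i* 0)%C * (f ((t + x) +i* y)%C - f (x +i* y)%C) - l) < e.
  move=> /Hl[r r0 Hr]; exists r => // t t0 tr; have := Hr (t +i* 0)%C.
  rewrite invx (_ : (t +i* 0)%C + (x +i* y)%C = ((t + x) +i* y)%C); last first.
    by rewrite -[y in RHS]add0r.
  apply; first by rewrite eq_complex /= negb_and t0.
  by rewrite /absC /= expr0n addr0 sqrtr_sqr.
have Hy (e : R) : 0 < e -> exists2 r, 0 < r & forall t : R, t != 0 -> `|t| < r ->
    absC ((0 +i* - t^-1)%C * (f (x +i* (t + y))%C - f (x +i* y)%C) - l) < e.
  move=> /Hl[r r0 Hr]; exists r => // t t0 tr; have := Hr (0 +i* t)%C.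
  rewrite invy (_ : (0 +i* t)%C + (x +i* y)%C = (x +i* (t + y))%C); last first.
    by rewrite -[x in RHS]add0r.
  apply; first by rewrite eq_complex /= negb_and t0 orbT.
  by rewrite /absC /= expr0n add0r sqrtr_sqr.
have Eax : ax = complex.Re l.
  apply: is_der_limit dax _ => e /Hx[r r0 Hr]; exists r => // t t0 tr.
  apply: le_lt_trans (Hr t t0 tr); apply: le_trans (absC_Re _); rewrite /re_part /plane_to_C /=.
  by case: (f _) (f _) => [? ?] [? ?] /=; case: (l) => ? ? /=; rewrite mul0r subr0.
have Ebx : bx = complex.Im l.
  apply: is_der_limit dbx _ => e /Hx[r r0 Hr]; exists r => // t t0 tr.
  apply: le_lt_trans (Hr t t0 tr); apply: le_trans (absC_Im _); rewrite /im_part /plane_to_C /=.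
  by case: (f _) (f _) => [? ?] [? ?] /=; case: (l) => ? ? /=; rewrite mul0r addr0.
have EbY : bY = complex.Re l.
  apply: is_der_limit dby _ => e /Hy[r r0 Hr]; exists r => // t t0 tr.
  apply: le_lt_trans (Hr t t0 tr); apply: le_trans (absC_Re _); rewrite /im_part /plane_to_C /=.
  by case: (f _) (f _) => [? ?] [? ?] /=; case: (l) => ? ? /=; rewrite mul0r sub0r mulNr opprK.
have EaY : aY = - complex.Im l.
  apply: is_der_limit day _ => e /Hy[r r0 Hr]; exists r => // t t0 tr.
  apply: le_lt_trans (Hr t t0 tr); apply: le_trans (absC_Im _); rewrite /re_part /plane_to_C /=.
  by case: (f _) (f _) => [? ?] [? ?] /=; case: (l) => ? ? /=;
    rewrite mul0r add0r mulNr -opprD normrN opprK.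
by rewrite Eax Ebx EbY EaY.
Qed.

End cauchy_riemann.

(** * Upper and lower estimates of plane integrals *)

Section plane_integrals.
Context {R : realType}.
Implicit Types (f g h : R * R -> R) (p : R * R) (A V : set (R * R)).

(** The quotient is continuous on the open set where [g] is nonzero, and constant on the rest
    because the inverse of 0 is 0. *)
Lemma measurable_fun_quotient V f g : open V ->
  (forall p, V p -> {for p, continuous f}) -> (forall p, V p -> {for p, continuous g}) ->
  measurable_fun V (fun p => f p / g p).
Proof.
move=> oV fc gc; pose V1 := [set p | V p /\ g p != 0].
have oV1 : open V1.
  rewrite openE => p [Vp gp]; apply: filterI; first exact: open_nbhs_nbhs.
  exact: (cvgr_neq0 _ (gc _ Vp) gp).
have mV := open2_measurable oV; have mV1 := open2_measurable oV1.
have -> : V = V1 `|` (V `\` V1).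
  apply/seteqP; split=> p; last by case=> -[].
  by move=> Vp; have [V1p|V1p] := pselect (V1 p); [left|right].
apply/measurable_funU => //; first exact: measurableD.
split.
  apply: open2_continuous_measurable_fun => // p [Vp gp]; apply: contM; first exact: fc.
  by apply: contV => //; exact: gc.
have E : {in V `\` V1, (fun=> 0) =1 (fun p => f p / g p)}.
  move=> p; rewrite inE => -[Vp nV1p]; have [->|gp] := eqVneq (g p) 0.
    by rewrite invr0 mulr0.
  by exfalso; apply: nV1p.
by apply: (eq_measurable_fun _ E); exact: measurable_cst.
Qed.

Lemma integral_upper A f (K : R) (x1 x2 y1 y2 : R) : measurable A -> measurable_fun A f ->
  x1 <= x2 -> y1 <= y2 -> A `<=` box x1 x2 y1 y2 ->
  (forall p, A p -> 0 <= f p <= K) -> 0 <= K ->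
  (\int[lam2 R]_(p in A) (f p)%:E <= (K * ((x2 - x1) * (y2 - y1)))%:E)%E.
Proof.
move=> mA mf xx yy AB fK K0.
apply: (@le_trans _ _ (\int[lam2 R]_(p in A) K%:E)%E).
  apply: ge0_le_integral => //.
  - by move=> p /fK /andP[]; rewrite lee_fin.
  - exact/measurable_EFinP.
  - by move=> p /fK /andP[]; rewrite lee_fin.
rewrite integral_cst// EFinM; apply: lee_wpmul2l; first by rewrite lee_fin.
rewrite -lam2_box//; apply: le_measure; rewrite ?inE//; exact: measurable_box.
Qed.

Lemma integral_lower A f (c : R) (x1 x2 y1 y2 : R) : measurable A -> measurable_fun A f ->
  x1 <= x2 -> y1 <= y2 -> box x1 x2 y1 y2 `<=` A ->
  (forall p, A p -> 0 <= f p) -> 0 <= c -> (forall p, box x1 x2 y1 y2 p -> c <= f p) ->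
  ((c * ((x2 - x1) * (y2 - y1)))%:E <= \int[lam2 R]_(p in A) (f p)%:E)%E.
Proof.
move=> mA mf xx yy BA f0 c0 cf.
have mB : measurable (box x1 x2 y1 y2) by exact: measurable_box.
apply: (@le_trans _ _ (\int[lam2 R]_(p in box x1 x2 y1 y2) (f p)%:E)%E).
  apply: (@le_trans _ _ (\int[lam2 R]_(p in box x1 x2 y1 y2) c%:E)%E).
    by rewrite integral_cst// EFinM; apply: lee_wpmul2l; rewrite ?lee_fin// -lam2_box.
  apply: ge0_le_integral => //.
  - by apply/measurable_EFinP; exact: measurable_funS mf.
by apply: ge0_subset_integral => //; exact/measurable_EFinP.
Qed.

(* Dyadic squares approaching [p0] each contribute the same positive amount. *)
Lemma inverse_square_nonintegrable A f (p0 : R * R) (c e : R) : measurable A ->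
  measurable_fun A f -> (forall p, A p -> 0 <= f p) -> 0 < c -> 0 < e ->
  box p0.1 (p0.1 + e) p0.2 (p0.2 + e) `<=` A ->
  (forall p, box p0.1 (p0.1 + e) p0.2 (p0.2 + e) p -> p != p0 -> c / r2 p0 p <= f p) ->
  (\int[lam2 R]_(p in A) (f p)%:E = +oo)%E.
Proof.
move=> mA mf f0 c0 e0 BA cf.
pose B t := box p0.1 (p0.1 + t) p0.2 (p0.2 + t).
have mB t : measurable (B t) by exact: measurable_box.
have BB (s t : R) : s <= t -> B s `<=` B t.
  by move=> st p /boxP[/andP[? ?] /andP[? ?]]; apply/boxP; split; apply/andP; split; lra.
have f0' (t : R) p : t <= e -> B t p -> (0 <= (f p)%:E)%E.
  by move=> te /(BB _ _ te) /BA /f0; rewrite lee_fin.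
have mfB (t : R) : t <= e -> measurable_fun (B t) f.
  by move=> te; apply: measurable_funS mf => //; exact: subset_trans (BB _ _ te) BA.
have step n (t : R) : 0 < t -> t <= e ->
    ((n%:R * (c / 8))%:E <= \int[lam2 R]_(p in B t) (f p)%:E)%E.
  elim: n t => [|n IH] t t0 te.
    by rewrite mul0r; apply: integral_ge0 => p; exact: f0'.
  have t2 : t / 2 <= e by lra.
  (* A strip disjoint from [B (t / 2)], of area t^2 / 4, on which [r2] <= 2 t^2; its share is c / 8
     whatever t is. *)
  pose C := box (p0.1 + 3 / 4 * t) (p0.1 + t) p0.2 (p0.2 + t).
  have mC : measurable C by exact: measurable_box.
  have CB : C `<=` B t.
    by move=> p /boxP[/andP[? ?] /andP[? ?]]; apply/boxP; split; apply/andP; split; lra.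
  have UB : B (t / 2) `|` C `<=` B t by rewrite subUset; split => //; apply: BB; lra.
  have mU : measurable (B (t / 2) `|` C) by exact: measurableU.
  pose U := B (t / 2) `|` C.
  apply: (@le_trans _ _ (\int[lam2 R]_(p in U) (f p)%:E)%E); last first.
    apply: ge0_subset_integral => //; first exact: mB.
      by apply/measurable_EFinP; exact: mfB.
    by move=> p; exact: f0'.
  rewrite /U ge0_integral_setU//; last 4 first.
  - exact: mB.
  - by apply/measurable_EFinP; apply: measurable_funS (mfB _ te).
  - by move=> p /UB; exact: f0'.
  - apply/disj_set2P; rewrite -subset0 => p [/boxP[/andP[_ h1] _] /boxP[/andP[h2 _] _]].
    by lra.
  rewrite -natr1 mulrDl mul1r EFinD; apply: leeD; first by apply: IH; lra.
  have := @integral_lower C f (c / (2 * t ^+ 2)) (p0.1 + 3 / 4 * t) (p0.1 + t) p0.2 (p0.2 + t) mC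
    (measurable_funS (mB t) CB (mfB _ te)).
  rewrite (_ : c / (2 * t ^+ 2) * _ = c / 8); last by field; rewrite gt_eqF.
  apply => //; [lra|lra| | |].
  - by move=> p /CB /(BB _ _ te) /BA /f0.
  - by rewrite divr_ge0 ?(ltW c0)// mulr_ge0// sqr_ge0.
  move=> p Cp; have /boxP[/andP[h1 h2] /andP[h3 h4]] := Cp.
  have pp0 : p != p0 by apply/eqP => pE; rewrite pE in h1; lra.
  apply: le_trans (cf p (BB _ _ te _ (CB _ Cp)) pp0).
  have r0 : 0 < r2 p0 p.
    rewrite /r2 ltr_wpDr ?sqr_ge0// exprn_gt0//; lra.
  rewrite ler_wpM2l ?(ltW c0)// lef_pV2 ?posrE ?mulr_gt0 ?exprn_gt0//.
  have g1 : (p.1 - p0.1) ^+ 2 <= t ^+ 2 by rewrite ler_sqr ?nnegrE; lra.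
  have g2 : (p.2 - p0.2) ^+ 2 <= t ^+ 2 by rewrite ler_sqr ?nnegrE; lra.
  by rewrite /r2; lra.
apply/eqyP => r _; have c8 : 0 < c / 8 by lra.
have [n Hn] := exists_large_nat (r / (c / 8)).
apply: (@le_trans _ _ (n%:R * (c / 8))%:E).
  by rewrite lee_fin ltW// -ltr_pdivrMr.
apply: (le_trans (step n e e0 (lexx e))).
by apply: ge0_subset_integral => //; [exact: mB|exact/measurable_EFinP].
Qed.

End plane_integrals.

(** * The two quotients in real coordinates, and discs *)

Section plane_form.
Context {R : realType}.
Implicit Types (u : CC R -> CC R) (p : R * R).

Lemma absC_half (w : CC R) : absC (2%:R^-1 * w) ^+ 2 =
  (complex.Re w ^+ 2 + complex.Im w ^+ 2) / 4.
Proof.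
rewrite absC_sqr (_ : 2%:R^-1 * w = ((2^-1)%:C)%C * w); last first.
  by rewrite rmorphV ?unitfE ?pnatr_eq0// rmorph_nat.
by case: w => c d /=; field.
Qed.

(** The case distinction disappears: at a zero of u the right side is a division by 0, whose value 0
    is the prescribed one. *)
Lemma sq_quotient_dbar u p : sq_quotient (dbar u) u (plane_to_C p) =
  (('D_(e1 R) (re_part u) p - 'D_(e2 R) (im_part u) p) ^+ 2 +
   ('D_(e1 R) (im_part u) p + 'D_(e2 R) (re_part u) p) ^+ 2) / 4 /
  (re_part u p ^+ 2 + im_part u p ^+ 2).
Proof.
rewrite /sq_quotient; have -> : re_part u p ^+ 2 + im_part u p ^+ 2 = absC (u (plane_to_C p)) ^+ 2.
  by rewrite absC_sqr.
case: eqP => [->|_]; first by rewrite absC_sqr /= !expr0n/= addr0 invr0 mulr0.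
congr (_ / _); rewrite /dbar absC_half /partial_C plane_to_CK /=.
congr (_ / _); move: ('D_(e1 R) (re_part u) p) ('D_(e2 R) (re_part u) p)
  ('D_(e1 R) (im_part u) p) ('D_(e2 R) (im_part u) p) => X Y Z T; ring.
Qed.

Lemma sq_quotient_del u p : sq_quotient (del u) u (plane_to_C p) =
  (('D_(e1 R) (re_part u) p + 'D_(e2 R) (im_part u) p) ^+ 2 +
   ('D_(e1 R) (im_part u) p - 'D_(e2 R) (re_part u) p) ^+ 2) / 4 /
  (re_part u p ^+ 2 + im_part u p ^+ 2).
Proof.
rewrite /sq_quotient; have -> : re_part u p ^+ 2 + im_part u p ^+ 2 = absC (u (plane_to_C p)) ^+ 2.
  by rewrite absC_sqr.
case: eqP => [->|_]; first by rewrite absC_sqr /= !expr0n/= addr0 invr0 mulr0.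
congr (_ / _); rewrite /del absC_half /partial_C plane_to_CK /=.
congr (_ / _); move: ('D_(e1 R) (re_part u) p) ('D_(e2 R) (re_part u) p)
  ('D_(e1 R) (im_part u) p) ('D_(e2 R) (im_part u) p) => X Y Z T; ring.
Qed.

Lemma cont_r2 (p0 p : R * R) : {for p, continuous (r2 p0)}.
Proof. by rewrite /r2; cont. Qed.

Lemma disc_plane (z0 : CC R) (r : R) : 0 < r ->
  @plane_to_C R @^-1` (disc z0 r) = [set p | r2 (C_to_plane z0) p < r ^+ 2].
Proof.
move=> r0; apply/seteqP.
have E (X : R) : (Num.sqrt X < r) = (X < r ^+ 2).
  by rewrite -[in LHS](ger0_norm (ltW r0)) -sqrtr_sqr ltr_sqrt ?exprn_gt0.
by split=> p; rewrite /disc /= absC_sub E.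
Qed.

Lemma open_r2_lt (p0 : R * R) (r : R) : open [set p | r2 p0 p < r].
Proof. by rewrite openE => p /= pr; exact: (cvgr_lt _ (cont_r2 (p := p)) _ pr). Qed.

Lemma r2_lt_box (p0 p : R * R) (r : R) : 0 < r -> r2 p0 p < r ^+ 2 ->
  box (p0.1 - r) (p0.1 + r) (p0.2 - r) (p0.2 + r) p /\ l1 p0 p < 2 * r.
Proof.
move=> r0 h; have a1 : `|p.1 - p0.1| < r.
  rewrite -(@ltr_sqr _ `|_|) ?nnegrE ?(ltW r0)// real_normK ?num_real//.
  by apply: le_lt_trans h; rewrite lerDl sqr_ge0.
have a2 : `|p.2 - p0.2| < r.
  rewrite -(@ltr_sqr _ `|_|) ?nnegrE ?(ltW r0)// real_normK ?num_real//.
  by apply: le_lt_trans h; rewrite lerDr sqr_ge0.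
split; last by rewrite /l1; lra.
by move: a1 a2; rewrite !ltr_norml => /andP[? ?] /andP[? ?]; apply/boxP; split; apply/andP; split; lra.
Qed.

End plane_form.

(** * From pointwise expansions to the integral order of vanishing *)

Section vanishing_order.
Context {R : realType}.
Variables (u : CC R -> CC R) (z0 : CC R) (W : set (R * R)).
Let p0 := C_to_plane z0.
Let a := re_part u.
Let b := im_part u.
Hypotheses (oW : open W) (Wp0 : W p0) (sa : smooth W a) (sb : smooth W b).

Let sqc p : W p -> {for p, continuous (fun p => a p ^+ 2 + b p ^+ 2)}.
Proof.
by move=> Wp; have ac := smooth_cont sa Wp; have bc := smooth_cont sb Wp; cont.
Qed.

Let D (r : R) := [set p | r2 p0 p < r ^+ 2].

Let area_disc (r : R) : 0 < r -> area_integral (disc z0 r) (fun z => absC (u z) ^+ 2) =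
  (\int[lam2 R]_(p in D r) (a p ^+ 2 + b p ^+ 2)%:E)%E.
Proof.
move=> r0; rewrite /area_integral disc_plane// -/p0 -/(D r); apply: eq_integral => p _.
by rewrite absC_sqr.
Qed.

Let small_disc : exists2 e : R, 0 < e & forall r : R, 0 < r -> r < e ->
  measurable (D r) /\
  measurable_fun (D r) (fun p => a p ^+ 2 + b p ^+ 2).
Proof.
have /nbhs_pairP[e e0 He] : nbhs p0 W by exact: open_nbhs_nbhs.
exists (e / 2); first by rewrite divr_gt0.
move=> r r0 re; have oD := @open_r2_lt R p0 (r ^+ 2).
split; first exact: open2_measurable.
apply: open2_continuous_measurable_fun => // p /= pr; apply: sqc; apply: He.
  have [_] := r2_lt_box r0 pr; rewrite /l1; have := normr_ge0 (p.2 - p0.2); lra.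
have [_] := r2_lt_box r0 pr; rewrite /l1; have := normr_ge0 (p.1 - p0.1); lra.
Qed.

(** Flatness to order m + 1 gives |u|^2 = O(r^(2m+2)) on a disc of area O(r^2). After division by
    r^m there remains r^(m+4), at most r for r <= 1. *)
Lemma flat_vanishes_to_infinite_order : flat_at p0 a -> flat_at p0 b ->
  vanishes_to_infinite_order u z0.
Proof.
move=> fa fb m.
have [Ca [da [Ca0 da0 Ha]]] := fa m.+1; have [Cb [db [Cb0 db0 Hb]]] := fb m.+1.
have [e e0 He] := small_disc.
pose K := (Ca ^+ 2 + Cb ^+ 2) * (2 ^+ m.+1) ^+ 2 * 4.
have K0 : 0 <= K by rewrite mulr_ge0// mulr_ge0 ?sqr_ge0// addr_ge0 ?sqr_ge0.
have [d1 [d10 d1a d1b]] := below_both da0 db0.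
have [d2 [d20 d2a d2b]] := below_both e0 d10.
have [d [d0 da' d1']] := below_both d20 (@ltr01 R).
apply: (@squeeze_cvge _ _ _ _ (fun=> 0%E) _ (fun r : R => (K * r)%:E)).
- exists (d / 2); first by rewrite /= divr_gt0.
  move=> r /=; rewrite sub0r normrN => rd r0; rewrite gtr0_norm// in rd.
  have re : r < e by lra.
  have [mD mf] := He r r0 re.
  rewrite area_disc//; apply/andP; split.
    rewrite mule_ge0 ?lee_fin ?invr_ge0 ?exprn_ge0 ?(ltW r0)//.
    by apply: integral_ge0 => p _; rewrite lee_fin addr_ge0 ?sqr_ge0.
  have rm0 : 0 < r ^+ m by rewrite exprn_gt0.
  pose L := (Ca ^+ 2 + Cb ^+ 2) * (2 ^+ m.+1) ^+ 2 * (r ^+ m.+1) ^+ 2.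
  apply: (@le_trans _ _ ((r ^- m)%:E *
    (L * ((p0.1 + r - (p0.1 - r)) * (p0.2 + r - (p0.2 - r))))%:E)%E).
    apply: lee_wpmul2l; first by rewrite lee_fin invr_ge0 ltW.
    apply: integral_upper => //; [lra|lra| | |].
    + by move=> p /= pr; have [] := r2_lt_box r0 pr.
    + move=> p /= pr; rewrite addr_ge0 ?sqr_ge0//=; have [_ lp] := r2_lt_box r0 pr.
      have key C g : 0 <= C -> `|g p| <= C * l1 p0 p ^+ m.+1 ->
          g p ^+ 2 <= C ^+ 2 * (2 ^+ m.+1) ^+ 2 * (r ^+ m.+1) ^+ 2.
        move=> C0 Hg; rewrite -(real_normK (num_real (g p))) -!exprMn.
        rewrite ler_sqr ?nnegrE ?mulr_ge0 ?exprn_ge0 ?(ltW r0)//.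
        apply: (le_trans Hg); rewrite -mulrA -exprMn ler_wpM2l//.
        by apply: lerXn2r; rewrite ?nnegrE ?l1_ge0 ?mulr_ge0 ?(ltW r0) ?(ltW lp).
      rewrite /L !mulrDl; apply: lerD.
        by apply: key => //; apply: Ha; lra.
      by apply: key => //; apply: Hb; lra.
    + by rewrite /L mulr_ge0 ?sqr_ge0// mulr_ge0 ?sqr_ge0// addr_ge0 ?sqr_ge0.
  rewrite -EFinM lee_fin (_ : r ^- m * _ = K * r * (r ^+ m * r ^+ 3)); last first.
    rewrite /L /K [r ^+ m.+1]exprS; move: (r ^+ m) rm0 (2 ^+ m.+1) => X X0 Y.
    by field; rewrite gt_eqF.
  have r1 : r <= 1 by lra.
  apply: ler_piMr; first exact: mulr_ge0 K0 (ltW r0).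
  by rewrite -exprD exprn_ile1// ltW.
- exact: cvg_cst.
- apply: cvg_EFin; first by near=> r.
  rewrite -[X in _ --> X](mulr0 K); apply: cvg_at_right_filter.
  by apply: cvgM; [exact: cvg_cst|exact: cvg_id].
Unshelve. all: by end_near. Qed.

Lemma lead_vanishes_to_finite_order j (c d : R) : (c, d) != (0, 0) ->
  lead_at p0 j c d a b -> vanishes_to_finite_order u z0.
Proof.
move=> cd0 L H; have [m [M [e1 [m0 _ e10 Hm]]]] := lead_bounds cd0 L.
have [e e0 He] := small_disc.
(* The box with x-offset in [r/4, r/2] and y-offset in [0, r/2] has area r^2 / 8 and [r2] >= r^2 /
   16 on it. So r^-(2j+2) times the integral stays at least [k] and cannot tend to 0. *)
pose k := m * (1 / 16) ^+ j / 8.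
have k0 : 0 < k by rewrite divr_gt0// mulr_gt0// exprn_gt0.
have nk : nbhs 0%E [set x : \bar R | (x < k%:E)%E].
  by apply: open_nbhs_nbhs; split; [exact: open_ereal_lt_ereal|rewrite /= lte_fin].
have [d1 /= d10 Hd] := H (2 * j + 2)%N _ nk.
have [d2 [d20 d21 d2e]] := below_both d10 e0.
have [r [r0 rd re]] := below_both d20 e10.
have [mD mf] := He r r0 (lt_trans rd d2e).
have /= := Hd r; rewrite sub0r normrN gtr0_norm// => /(_ (lt_trans rd d21) r0).
rewrite area_disc// ltNge => /negP; apply.
have lo : ((m * (r ^+ 2 / 16) ^+ j * ((p0.1 + r / 2 - (p0.1 + r / 4)) * (p0.2 + r / 2 - p0.2)))%:E <=
    \int[lam2 R]_(p in D r) (a p ^+ 2 + b p ^+ 2)%:E)%E.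
  apply: integral_lower => //; [lra|lra| | | |].
  - move=> p /boxP[/andP[h1 h2] /andP[h3 h4]].
    have g1 : (p.1 - p0.1) ^+ 2 <= (r / 2) ^+ 2 by rewrite ler_sqr ?nnegrE; lra.
    have g2 : (p.2 - p0.2) ^+ 2 <= (r / 2) ^+ 2 by rewrite ler_sqr ?nnegrE; lra.
    have r20 : 0 < r ^+ 2 := exprn_gt0 2 r0.
    have h : (p.1 - p0.1) ^+ 2 + (p.2 - p0.2) ^+ 2 < r ^+ 2.
      by move: (p.1 - p0.1) (p.2 - p0.2) g1 g2 => X Y g1 g2; lra.
    exact: h.
  - by move=> p _; rewrite addr_ge0 ?sqr_ge0.
  - by rewrite mulr_ge0 ?(ltW m0)// exprn_ge0// divr_ge0 ?sqr_ge0.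
  move=> p /boxP[/andP[h1 h2] /andP[h3 h4]] /=.
  have lp : l1 p0 p < e1 by rewrite /l1 !ger0_norm; lra.
  have /andP[h _] := Hm p lp; apply: le_trans h; rewrite ler_wpM2l ?(ltW m0)//.
  apply: lerXn2r; rewrite ?nnegrE ?r2_ge0 ?divr_ge0 ?sqr_ge0//.
  have g1 : (r / 4) ^+ 2 <= (p.1 - p0.1) ^+ 2 by rewrite ler_sqr ?nnegrE; lra.
  by rewrite /r2; have := sqr_ge0 (p.2 - p0.2); lra.
apply: (le_trans _ (lee_wpmul2l _ lo)); last by rewrite lee_fin invr_ge0 exprn_ge0// ltW.
rewrite -EFinM lee_fin /k.
rewrite (_ : r ^- _ * _ = m * (1 / 16) ^+ j / 8) // exprMn exprD exprM.
have rj : (r ^+ 2) ^+ j != 0 by rewrite expf_neq0// expf_neq0// gt_eqF.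
rewrite [(1 / 16) ^+ j]exprMn expr1n mul1r.
by move: ((r ^+ 2) ^+ j) rj (16^-1 ^+ j) => X X0 Y; field; rewrite X0 gt_eqF.
Qed.

End vanishing_order.

Lemma r2_gt0 (R : realType) (p0 p : R * R) : p != p0 -> 0 < r2 p0 p.
Proof.
move=> pp0; rewrite lt_neqAle r2_ge0 andbT; apply: contra pp0 => /eqP/esym/eqP.
rewrite /r2 paddr_eq0 ?sqr_ge0// !expf_eq0 /= !subr_eq0.
by case: p p0 => [? ?] [? ?] /= /andP[/eqP -> /eqP ->].
Qed.

(** Used with D = |u|^2 and r the power j + 1 of the squared distance, to which |u|^2 is
    comparable. *)
Lemma dbar_quotient_upper (R : realFieldType) (ax ay bx bY D r m : R) :
  0 < m -> m * r <= D -> (bY - ax) ^+ 2 <= 1 * r -> (ay + bx) ^+ 2 <= 1 * r ->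
  ((ax - bY) ^+ 2 + (bx + ay) ^+ 2) / 4 / D <= 1 / (2 * m).
Proof.
move=> m0 mD h1 h2; have r0 : 0 <= r by have := sqr_ge0 (bY - ax); lra.
have : 0 <= D by apply: le_trans mD; rewrite mulr_ge0// ltW.
rewrite le_eqVlt => /orP[/eqP <-|D0]; first by rewrite invr0 mulr0 divr_ge0// mulr_ge0// ltW.
rewrite ler_pdivrMr// mulrAC ler_pdivlMr ?mulr_gt0// mul1r.
have : (ax - bY) ^+ 2 + (bx + ay) ^+ 2 <= 2 * r by lra.
rewrite -(ler_pM2r m0) => h; lra.
Qed.

(** Used with t the squared distance and r = t^j. In 2 del u = 2 u_x - 2 dbar u the last term is
    small: the numerator is at least 2 m r - m r. *)
Lemma del_quotient_lower (R : realFieldType) (ax ay bx bY D t r m M : R) :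
  0 < m -> 0 < M -> 0 < t -> 0 < r -> 0 < D -> D <= M * (t * r) ->
  m * r <= ax ^+ 2 + bx ^+ 2 ->
  (bY - ax) ^+ 2 <= m / 2 * r -> (ay + bx) ^+ 2 <= m / 2 * r ->
  m / (4 * M) / t <= ((ax + bY) ^+ 2 + (bx - ay) ^+ 2) / 4 / D.
Proof.
move=> m0 M0 t0 r0 D0 DM h h1 h2.
have N0 : m * r <= (ax + bY) ^+ 2 + (bx - ay) ^+ 2.
  have := sqr_ge0 (ax + (bY - ax)); have := sqr_ge0 (bx - (ay + bx)); lra.
rewrite ler_pdivlMr//; apply: (@le_trans _ _ (m * r / 4)); last by lra.
apply: (@le_trans _ _ (m / (4 * M) / t * (M * (t * r)))).
  by rewrite ler_wpM2l// !divr_ge0 ?mulr_ge0 ?(ltW m0) ?(ltW M0) ?(ltW t0).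
by rewrite le_eqVlt; apply/orP; left; apply/eqP; field; rewrite !gt_eqF.
Qed.

Lemma measurable_gradient_quotients (R : realType) (V : set (R * R))
    (a ax ay b bx bY : R * R -> R) : open V ->
  (forall p, V p -> {for p, continuous a}) -> (forall p, V p -> {for p, continuous ax}) ->
  (forall p, V p -> {for p, continuous ay}) -> (forall p, V p -> {for p, continuous b}) ->
  (forall p, V p -> {for p, continuous bx}) -> (forall p, V p -> {for p, continuous bY}) ->
  measurable_fun V (fun p => ((ax p - bY p) ^+ 2 + (bx p + ay p) ^+ 2) / 4 /
    (a p ^+ 2 + b p ^+ 2)) /\
  measurable_fun V (fun p => ((ax p + bY p) ^+ 2 + (bx p - ay p) ^+ 2) / 4 /
    (a p ^+ 2 + b p ^+ 2)).
Proof.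
move=> oV ac axc ayc bc bxc byc.
by split; apply: measurable_fun_quotient => // p Vp; cont.
Qed.

(** * The two cases for the given extension, and the theorem *)

Section main_argument.
Context {R : realType}.
Variables (Omega : set (CC R)) (z0 : CC R) (f : CC R -> CC R) (N : set (CC R)) (u : CC R -> CC R).
Hypotheses (Omega_open : open Omega) (Omega_connected : connected Omega)
    (z0_boundary : boundary Omega z0)
    (f_holomorphic : holomorphic_on Omega f)
    (f_nonconstant : nonconstant_on Omega f)
    (u_extends_f : smooth_extension_across Omega z0 f N u)
    (u_z0 : u z0 = 0).

Let W := @plane_to_C R @^-1` (Omega `|` N).
Let S := @plane_to_C R @^-1` Omega.
Let N' := @plane_to_C R @^-1` N.
Let p0 := C_to_plane z0.
Let a := re_part u.
Let b := im_part u.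

Let oN : open N. Proof. by have [] := u_extends_f. Qed.
Let oW : open W. Proof. by apply: open_plane; exact: openU. Qed.
Let oS : open S. Proof. exact: open_plane. Qed.
Let oN' : open N'. Proof. exact: open_plane. Qed.
Let SW : S `<=` W. Proof. by move=> p Sp; left. Qed.
Let NW : N' `<=` W. Proof. by move=> p Np; right. Qed.
Let Np0 : N' p0. Proof. by have [_ + _ _] := u_extends_f; rewrite /N' /= C_to_planeK. Qed.
Let Wp0 : W p0. Proof. exact: NW. Qed.
Let sa : smooth W a. Proof. by have [_ _ + _] := u_extends_f => + k => /(_ k)[]. Qed.
Let sb : smooth W b. Proof. by have [_ _ + _] := u_extends_f => + k => /(_ k)[]. Qed.
Let Sp0 : closure S p0. Proof. by apply: closure_plane; have [] := z0_boundary. Qed.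

Let CR p : S p -> 'D_(e2 R) b p = 'D_(e1 R) a p /\ 'D_(e2 R) a p = - 'D_(e1 R) b p.
Proof.
case: p => x y Sp; have Wp := SW Sp.
have du : derivable u (x +i* y)%C (1 : CC R).
  apply: near_eq_derivable (f_holomorphic Sp).
  apply: filterS (open_nbhs_nbhs (conj Omega_open Sp)) => z Oz.
  by have [_ _ _ ->] := u_extends_f.
exact: (cauchy_riemann du (smooth_der1 sa Wp) (smooth_der1 sb Wp)
  (smooth_der2 sa Wp) (smooth_der2 sb Wp)).
Qed.

Let CR1 p : S p -> 'D_(e2 R) b p = 'D_(e1 R) a p. Proof. by case/CR. Qed.
Let CR2 p : S p -> 'D_(e2 R) a p = - 'D_(e1 R) b p. Proof. by case/CR. Qed.

Let zeroE p : a p = 0 -> b p = 0 -> u (plane_to_C p) = 0.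
Proof. by rewrite /a /b /re_part /im_part; case: (u _) => ? ? /= -> ->. Qed.

Let zero_set := [set p | a p = 0 /\ b p = 0].

Let zero_near_flat p : S p -> flat_at p a -> flat_at p b -> interior zero_set p.
Proof.
move=> Sp fa fb.
have /nbhs_pairP[r r0 Hr] : nbhs p S by exact: open_nbhs_nbhs.
have BS : box (p.1 - r / 2) (p.1 + r / 2) (p.2 - r / 2) (p.2 + r / 2) `<=` S.
  move=> q /boxP[/andP[h1 h2] /andP[h3 h4]]; apply: Hr.
    by rewrite ltr_norml; apply/andP; split; lra.
  by rewrite ltr_norml; apply/andP; split; lra.
have r2 : 0 < r / 2 by rewrite divr_gt0.
have := @unique_continuation R W a _ _ _ b _ _ _ (fun=> 0) p (r / 2) oW
  (smooth_C2 oW sa) (smooth_C2 oW sb) fa fb r2 (subset_trans BS SW) (fun=> lexx 0).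
case.
- rewrite (_ : EFin \o _ = cst 0%E); last by apply/funext.
  exact: integrable0.
- rewrite [X in _.-negligible X](_ : _ = set0); first exact: negligible_set0.
  rewrite -subset0 => q [/BS Sq]; have [-> ->] := CR Sq.
  by rewrite subrr addrN expr0n /= addr0 mulr0 mul0r eqxx.
by move=> d d0 Hd; apply/nbhs_pairP; exists d.
Qed.

Let not_zero_near : ~ interior zero_set p0.
Proof.
move=> Zp0; have /Sp0[q0 [Sq0 q0Z]] : nbhs p0 (interior zero_set).
  by apply: open_nbhs_nbhs; split => //; exact: open_interior.
pose B := Omega `&` (@C_to_plane R @^-1` (interior zero_set)).
have oB : open B by apply: openI => //; apply: open_C; exact: open_interior.
have BE : B = Omega.
  apply: Omega_connected.
  - by exists (plane_to_C q0); split => //; rewrite /= plane_to_CK.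
  - exists (@C_to_plane R @^-1` (interior zero_set)) => //.
    by apply: open_C; exact: open_interior.
  exists (closure B); first exact: closed_closure.
  apply/seteqP; split=> z; first by move=> Bz; split; [case: Bz|exact: subset_closure].
  move=> [Oz /closure_plane Bz]; split => //.
  have Sz : S (C_to_plane z) by rewrite /S /= C_to_planeK.
  pose S' := @plane_to_C R @^-1` B.
  have S'Z q : S' q -> a q = 0 /\ b q = 0.
    by move=> [_]; rewrite /= plane_to_CK => /interior_subset.
  have oS' : open S' by exact: open_plane.
  have S'W : S' `<=` W by move=> q [Oq _]; left.
  apply: zero_near_flat => // k.
    (* Vanishing on [S'] in the form required by [flat_of_eq], with factor 0; the difference there
       is then [a] itself. *)
    have h q : S' q -> a q = 0 * a q by case/S'Z => ->; rewrite mulr0.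
    by apply: O_at_eq (flat_of_eq oW oS' S'W (SW Sz) Bz sa sa h k) => q; rewrite mul0r subr0.
  have h q : S' q -> b q = 0 * b q by case/S'Z => _ ->; rewrite mulr0.
  by apply: O_at_eq (flat_of_eq oW oS' S'W (SW Sz) Bz sb sb h k) => q; rewrite mul0r subr0.
apply: f_nonconstant; exists 0 => z Oz; have := Oz; rewrite -BE => -[_ /interior_subset[h1 h2]].
by have [_ _ _ <-//] := u_extends_f; rewrite -(C_to_planeK z) zeroE.
Qed.

Let dbar_quotient p := (('D_(e1 R) a p - 'D_(e2 R) b p) ^+ 2 +
   ('D_(e1 R) b p + 'D_(e2 R) a p) ^+ 2) / 4 / (a p ^+ 2 + b p ^+ 2).
Let del_quotient p := (('D_(e1 R) a p + 'D_(e2 R) b p) ^+ 2 +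
   ('D_(e1 R) b p - 'D_(e2 R) a p) ^+ 2) / 4 / (a p ^+ 2 + b p ^+ 2).

Let dbar_quotient_ge0 p : 0 <= dbar_quotient p.
Proof. by rewrite divr_ge0 ?divr_ge0 ?addr_ge0 ?sqr_ge0. Qed.

Let del_quotient_ge0 p : 0 <= del_quotient p.
Proof. by rewrite divr_ge0 ?divr_ge0 ?addr_ge0 ?sqr_ge0. Qed.

Let area_dbar U : area_integral U (sq_quotient (dbar u) u) =
  (\int[lam2 R]_(p in @plane_to_C R @^-1` U) (dbar_quotient p)%:E)%E.
Proof. by apply: eq_integral => p _; rewrite sq_quotient_dbar. Qed.

Let area_del U : area_integral U (sq_quotient (del u) u) =
  (\int[lam2 R]_(p in @plane_to_C R @^-1` U) (del_quotient p)%:E)%E.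
Proof. by apply: eq_integral => p _; rewrite sq_quotient_del. Qed.

Let measurable_quotients V : open V -> V `<=` W ->
  measurable_fun V dbar_quotient /\ measurable_fun V del_quotient.
Proof.
move=> oV VW.
have ac p : V p -> {for p, continuous a} by move=> /VW; exact: smooth_cont.
have bc p : V p -> {for p, continuous b} by move=> /VW; exact: smooth_cont.
have axc p : V p -> {for p, continuous ('D_(e1 R) a)}.
  by move=> /VW; apply: smooth_cont; exact: smooth_D1.
have ayc p : V p -> {for p, continuous ('D_(e2 R) a)}.
  by move=> /VW; apply: smooth_cont; exact: smooth_D2.
have bxc p : V p -> {for p, continuous ('D_(e1 R) b)}.
  by move=> /VW; apply: smooth_cont; exact: smooth_D1.
have byc p : V p -> {for p, continuous ('D_(e2 R) b)}.
  by move=> /VW; apply: smooth_cont; exact: smooth_D2.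
exact: (measurable_gradient_quotients oV ac axc ayc bc bxc byc).
Qed.

(* Where u = 0 the quotient is the junk value 0; the zeros of u with a nonzero gradient
   form a null set. *)
Let zero_dbar_negligible : (lam2 R).-negligible [set p | W p /\
  ('D_(e1 R) a p - 'D_(e2 R) b p) ^+ 2 + ('D_(e1 R) b p + 'D_(e2 R) a p) ^+ 2 !=
  4 * dbar_quotient p * (a p ^+ 2 + b p ^+ 2)].
Proof.
have Zx g : smooth W g -> (lam2 R).-negligible [set p | [/\ W p, g p = 0 & 'D_(e1 R) g p != 0]].
  move=> sg; exact: (lam2_simple_zeros_x oW (fun p => smooth_cont sg)
    (fun p => smooth_cont (smooth_D1 sg)) (fun x y => @smooth_der1 _ _ g x y sg)).
have Zy g : smooth W g -> (lam2 R).-negligible [set p | [/\ W p, g p = 0 & 'D_(e2 R) g p != 0]].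
  move=> sg; exact: (lam2_simple_zeros_y oW (fun p => smooth_cont sg)
    (fun p => smooth_cont (smooth_D2 sg)) (fun x y => @smooth_der2 _ _ g x y sg)).
have := negligibleU (negligibleU (Zx a sa) (Zy a sa)) (negligibleU (Zx b sb) (Zy b sb)).
apply: negligibleS => p [Wp].
have [u0|u0] := eqVneq (a p ^+ 2 + b p ^+ 2) 0; last first.
  by rewrite /dbar_quotient; move: (_ ^+ 2 + _ ^+ 2) u0 => X X0;
    rewrite mulrA mulfVK// mulrC divfK// eqxx.
have [a0 b0] : a p = 0 /\ b p = 0.
  move/eqP: u0; rewrite paddr_eq0 ?sqr_ge0// !expf_eq0/= => /andP[/eqP -> /eqP ->].
  by split.
rewrite u0 mulr0; have [ax0|?] := eqVneq ('D_(e1 R) a p) 0; last by move=> _; left; left.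
have [ay0|?] := eqVneq ('D_(e2 R) a p) 0; last by move=> _; left; right.
have [bx0|?] := eqVneq ('D_(e1 R) b p) 0; last by move=> _; right; left.
have [by0|?] := eqVneq ('D_(e2 R) b p) 0; last by move=> _; right; right.
by rewrite ax0 ay0 bx0 by0 subrr addr0 expr0n/= addr0 eqxx.
Qed.

Let flat_case : flat_at p0 a -> flat_at p0 b ->
  area_integral N (sq_quotient (dbar u) u) = +oo%E.
Proof.
move=> fa fb; apply/eqP/negPn/negP; rewrite area_dbar -/N' => Ioo.
have [mq _] := measurable_quotients oN' NW.
have mN' := open2_measurable oN'.
have iq : (lam2 R).-integrable N' (EFin \o dbar_quotient).
  apply/integrableP; split; first exact/measurable_EFinP.
  under eq_integral do rewrite /= ger0_norm//.
  by rewrite ltey.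
have /nbhs_pairP[r r0 Hr] : nbhs p0 N' by exact: open_nbhs_nbhs.
pose B := box (p0.1 - r / 2) (p0.1 + r / 2) (p0.2 - r / 2) (p0.2 + r / 2).
have BN : B `<=` N'.
  move=> q /boxP[/andP[h1 h2] /andP[h3 h4]]; apply: Hr.
    by rewrite ltr_norml; apply/andP; split; lra.
  by rewrite ltr_norml; apply/andP; split; lra.
have r2 : 0 < r / 2 by rewrite divr_gt0.
have mB : measurable B by exact: measurable_box.
have iB : (lam2 R).-integrable B (EFin \o dbar_quotient) by apply: integrableS iq.
have nB : (lam2 R).-negligible [set p | B p /\
    ('D_(e1 R) a p - 'D_(e2 R) b p) ^+ 2 + ('D_(e1 R) b p + 'D_(e2 R) a p) ^+ 2 !=
    4 * dbar_quotient p * (a p ^+ 2 + b p ^+ 2)].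
  by apply: negligibleS zero_dbar_negligible => q [Bq h]; split => //; exact: NW (BN _ Bq).
have [d d0 Hd] := unique_continuation oW (smooth_C2 oW sa) (smooth_C2 oW sb) fa fb r2
  (subset_trans BN NW) dbar_quotient_ge0 iB nB.
by apply: not_zero_near; apply/nbhs_pairP; exists d.
Qed.

Let lead_case j (c d : R) : (c, d) != (0, 0) ->
  lead_at p0 j c d ('D_(e1 R) a) ('D_(e1 R) b) ->
  lead_at p0 j.+1 (c / j.+1%:R) (d / j.+1%:R) a b ->
  exists U, [/\ open U, U z0, U `<=` N,
    (area_integral U (sq_quotient (dbar u) u) < +oo)%E &
    area_integral U (sq_quotient (del u) u) = +oo%E].
Proof.
move=> cd0 L L'.
have cd0' : (c / j.+1%:R, d / j.+1%:R) != (0, 0).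
  apply: contra cd0 => /eqP[/eqP + /eqP]; rewrite !mulf_eq0 !invr_eq0 !pnatr_eq0 !orbF.
  by move=> /eqP -> /eqP ->.
have [m [M [ea [m0 M0 ea0 Hm]]]] := lead_bounds cd0 L.
have [m' [M' [eb [m'0 M'0 eb0 Hm']]]] := lead_bounds cd0' L'.
have [F1 F2] := cauchy_riemann_defect_flat oW oS SW Wp0 Sp0 sa sb CR1 CR2.
(* Order j + 2 makes |dbar u|^2 comparable with |u|^2, of size [r2]^(j+1). The bounds of order j + 1
   below, with constant m / 2, serve the comparison with |u_x|^2, of size [r2]^j. *)
have [ec ec0 H1] := O_at_small (F1 j.+2) (@ltr01 R).
have [ed ed0 H2] := O_at_small (F2 j.+2) (@ltr01 R).
have m2 : 0 < m / 2 by rewrite divr_gt0.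
have [ee ee0 H3] := O_at_small (F1 j.+1) m2.
have [ef ef0 H4] := O_at_small (F2 j.+1) m2.
have /nbhs_pairP[r r0 Hr] : nbhs p0 N' by exact: open_nbhs_nbhs.
have [e1 [e10 e1a e1b]] := below_both ea0 eb0.
have [e2 [e20 e2a e2b]] := below_both ec0 ed0.
have [e3 [e30 e3a e3b]] := below_both ee0 ef0.
have [e4 [e40 e4a e4b]] := below_both e10 e20.
have [e5 [e50 e5a e5b]] := below_both e30 r0.
have [e6 [e60 e6a e6b]] := below_both e40 e50.
have e64 := lt_trans e6a; have e65 := lt_trans e6b.
have e61 p : l1 p0 p < e6 -> l1 p0 p < e1 by move=> h; apply: lt_trans h (e64 _ e4a).
have e62 p : l1 p0 p < e6 -> l1 p0 p < e2 by move=> h; apply: lt_trans h (e64 _ e4b).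
have e63 p : l1 p0 p < e6 -> l1 p0 p < e3 by move=> h; apply: lt_trans h (e65 _ e5a).
have e0 : 0 < e6 / 2 by rewrite divr_gt0.
pose V := [set p | r2 p0 p < (e6 / 2) ^+ 2].
have oV : open V by exact: open_r2_lt.
have Vl p : V p -> l1 p0 p < e6.
  by move=> /(r2_lt_box e0)[_]; rewrite mulrC divfK.
have VB p : V p -> box (p0.1 - e6 / 2) (p0.1 + e6 / 2) (p0.2 - e6 / 2) (p0.2 + e6 / 2) p.
  by move=> /(r2_lt_box e0)[].
have VN : V `<=` N'.
  move=> p /Vl /lt_trans/(_ (e65 _ e5b)) lr.
  by apply: Hr; apply: le_lt_trans lr; rewrite /l1 ?lerDl ?lerDr.
have BV : box p0.1 (p0.1 + e6 / 4) p0.2 (p0.2 + e6 / 4) `<=` V.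
  move=> p /boxP[Bx By]; have Bx' : p0.1 - e6 / 4 <= p.1 <= p0.1 + e6 / 4.
    by move/andP: Bx => [? ?]; apply/andP; split; lra.
  have By' : p0.2 - e6 / 4 <= p.2 <= p0.2 + e6 / 4.
    by move/andP: By => [? ?]; apply/andP; split; lra.
  have := sqr_diff_le Bx'; have := sqr_diff_le By'; have := exprn_gt0 2 e60.
  have : r2 p0 p = (p.1 - p0.1) ^+ 2 + (p.2 - p0.2) ^+ 2 by [].
  rewrite /V /=; move: (p.1 - p0.1) (p.2 - p0.2) (r2 p0 p) => X Y Z -> *; lra.
have UV : @plane_to_C R @^-1` (@C_to_plane R @^-1` V) = V.
  by apply/seteqP; split=> p; rewrite /= plane_to_CK.
have [mdb mdel] := measurable_quotients oV (subset_trans VN NW).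
have mV := open2_measurable oV.
exists (@C_to_plane R @^-1` V); split.
- exact: open_C.
- by rewrite /V /= /r2 !subrr !expr0n/= addr0 exprn_gt0.
- by move=> z /VN; rewrite /N' /= C_to_planeK.
- rewrite area_dbar UV.
  apply: le_lt_trans (integral_upper (K := 1 / (2 * m')) mV mdb _ _ VB _ _) _.
  + lra.
  + lra.
  + move=> p Vp; rewrite dbar_quotient_ge0 /=; have lp := Vl p Vp.
    have h1 := H1 p (lt_trans (e62 p lp) e2a); have h2 := H2 p (lt_trans (e62 p lp) e2b).
    have /andP[h3 _] := Hm' p (lt_trans (e61 p lp) e1b).
    exact: (dbar_quotient_upper m'0 h3 h1 h2).
  + by rewrite divr_ge0 ?mulr_ge0 ?(ltW m'0).
  + by rewrite ltry.
rewrite area_del UV.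
apply: (@inverse_square_nonintegrable _ V del_quotient p0 (m / (4 * M')) (e6 / 4)) => //.
- by rewrite divr_gt0// mulr_gt0.
- by rewrite divr_gt0.
move=> p Bp pp0; have Vp := BV _ Bp; have lp := Vl p Vp.
have h1 := H3 p (lt_trans (e63 p lp) e3a); have h2 := H4 p (lt_trans (e63 p lp) e3b).
have /andP[h3 _] := Hm p (lt_trans (e61 p lp) e1a).
have /andP[h4 h5] := Hm' p (lt_trans (e61 p lp) e1b).
have t0 := r2_gt0 pp0.
have tj : 0 < r2 p0 p ^+ j by rewrite exprn_gt0.
have D0 : 0 < a p ^+ 2 + b p ^+ 2.
  by apply: lt_le_trans h4; rewrite mulr_gt0// exprn_gt0.
rewrite [r2 p0 p ^+ j.+1]exprS in h5.
exact: (del_quotient_lower m0 M'0 t0 tj D0 h5 h3 h1 h2).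
Qed.

(** Flatness excludes finite order and a leading term excludes infinite order, so in each case one
    implication is vacuous: [N] serves in the flat case, a small disc in the other. *)
Lemma dichotomy_integrals : exists U : set (CC R),
    [/\ open U, U z0, U `<=` N,
        (vanishes_to_finite_order u z0 ->
           (area_integral U (sq_quotient (dbar u) u) < +oo)%E /\
           area_integral U (sq_quotient (del u) u) = +oo%E) &
        (vanishes_to_infinite_order u z0 ->
           area_integral U (sq_quotient (dbar u) u) = +oo%E)].
Proof.
have a0 : a p0 = 0 by rewrite /a /re_part C_to_planeK u_z0.
have b0 : b p0 = 0 by rewrite /b /im_part C_to_planeK u_z0.
have [[fa fb]|[j [c [d [cd0 L L']]]]] := flat_or_lead oW oS SW Wp0 Sp0 sa sb CR1 CR2 a0 b0.
  exists N; split => //; [by have [] := u_extends_f| |by move=> _; exact: flat_case].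
  move=> fin; exfalso; apply: fin.
  exact: (flat_vanishes_to_infinite_order oW Wp0 sa sb fa fb).
have [U [oU Uz0 UN db dl]] := lead_case cd0 L L'.
exists U; split => // inf; exfalso.
have cd0' : (c / j.+1%:R, d / j.+1%:R) != (0, 0).
  apply: contra cd0 => /eqP[/eqP + /eqP]; rewrite !mulf_eq0 !invr_eq0 !pnatr_eq0 !orbF.
  by move=> /eqP -> /eqP ->.
exact: (lead_vanishes_to_finite_order oW Wp0 sa sb cd0' L').
Qed.

End main_argument.

Theorem proposition5p2 (R : realType) (Omega : set (CC R)) (z0 : CC R)
    (f : CC R -> CC R) (N : set (CC R)) (u : CC R -> CC R)
    (Omega_open : open Omega) (Omega_connected : connected Omega)
    (z0_boundary : boundary Omega z0)
    (f_holomorphic : holomorphic_on Omega f)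
    (f_nonconstant : nonconstant_on Omega f)
    (u_extends_f : smooth_extension_across Omega z0 f N u)
    (u_z0 : u z0 = 0) :
  exists U : set (CC R),
    [/\ open U, U z0, U `<=` N,
        (vanishes_to_finite_order u z0 ->
           (area_integral U (sq_quotient (dbar u) u) < +oo)%E /\
           area_integral U (sq_quotient (del u) u) = +oo%E) &
        (vanishes_to_infinite_order u z0 ->
           area_integral U (sq_quotient (dbar u) u) = +oo%E)].
Proof.
exact: (dichotomy_integrals Omega_open Omega_connected z0_boundary f_holomorphic
  f_nonconstant u_extends_f u_z0).
Qed.
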